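(* Let $B_1,B_2\subset\mathbb{R}^2$ be two disks of the same radius $r>0$ separated by a distance $\epsilon>0$, and let $\mathbb{K}_\epsilon^*$ be the associated Neumann-Poincaré operator. Then $\mathbb{K}_\epsilon^*$ has the spectral decomposition $$\mathbb{K}_\epsilon^*=\sum_{n\neq0}\frac12e^{-2|n|\xi_0}\,\Psi_{\epsilon,n}^+\otimes\Psi_{\epsilon,n}^+ +\sum_{n\ne0}\left(-\frac12e^{-2|n|\xi_0}\right)\Psi_{\epsilon,n}^-\otimes\Psi_{\epsilon,n}^-,$$ where $n$ ranges over the nonzero integers and $\Psi_{\epsilon,n}^\pm$ are the normalized eigenvectors defined by $$\Psi_{\epsilon,n}^\pm(\theta)=\frac{\sqrt{|n|}\,e^{in\theta}}{\sqrt{2\pi(1\mp e^{-2|n|\xi_0})}}\begin{bmatrix}h(-\xi_0,\theta)\\ \mp h(\xi_0,\theta)\end{bmatrix}.$$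
   Context: Set $\alpha=\sqrt{\epsilon(r+\epsilon/4)}$ and $\xi_0=\sinh^{-1}(\alpha/r)$. Cartesian coordinates $(x,y)$ are chosen so that the centers of the disks lie on the $x$-axis, symmetrically about the origin, with $B_1$ in $\{x<0\}$ and $B_2$ in $\{x>0\}$. Bipolar coordinates $(\xi,\theta)\in\mathbb{R}\times(-\pi,\pi]$ are defined by $$x=\alpha\frac{\sinh\xi}{\cosh\xi-\cos\theta},\qquad y=\alpha\frac{\sin\theta}{\cosh\xi-\cos\theta}.$$ In these coordinates $\partial B_j=\{\xi=(-1)^j\xi_0\}$ for $j=1,2$. Let $h(\xi,\theta)=\frac{\cosh\xi-\cos\theta}{\alpha}$; the line element on $\{\xi=\pm\xi_0\}$ is $d\sigma=h(\xi_0,\theta)^{-1}d\theta$. Functions on $\partial B_j$ are regarded as functions of $\theta$. For a disk $B$ with outward unit normal $\nu$, let $$\mathcal{S}_{B}[\varphi](x)=\frac1{2\pi}\int_{\partial B}\ln|x-y|\,\varphi(y)\,d\sigma(y)\ (x\in\mathbb{R}^2),\qquad \mathcal{K}_{B}^*[\varphi](x)=\frac1{2\pi}\int_{\partial B}\frac{\langle x-y,\nu_x\rangle}{|x-y|^2}\varphi(y)\,d\sigma(y)\ (x\in\partial B).$$ With $\nu^{(i)}$ the outward normal on $\partial B_i$, define, for pairs in $L^2(\partial B_1)\times L^2(\partial B_2)$, $$\mathbb{K}_\epsilon^*=\begin{bmatrix}\mathcal{K}_{B_1}^*&\frac{\partial}{\partial\nu^{(1)}}\mathcal{S}_{B_2}\\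 \frac{\partial}{\partial\nu^{(2)}}\mathcal{S}_{B_1}&\mathcal{K}_{B_2}^*\end{bmatrix},\qquad \mathbb{S}=\begin{bmatrix}\mathcal{S}_{B_1}&\mathcal{S}_{B_2}\\ \mathcal{S}_{B_1}&\mathcal{S}_{B_2}\end{bmatrix},$$ where the first row is evaluated on $\partial B_1$ and the second on $\partial B_2$. The inner product with respect to which $\mathbb{K}_\epsilon^*$ is self-adjoint is $\langle\varphi,\psi\rangle_{\mathcal{H}}=-\langle\varphi,\mathbb{S}[\psi]\rangle$ for $\varphi,\psi\in L^2(\partial B_1)\times L^2(\partial B_2)$, where $\langle f,g\rangle=\sum_{j=1}^2\int_{\partial B_j}f_j\overline{g_j}\,d\sigma$. ''Normalized'' means $\langle\Psi,\Psi\rangle_{\mathcal{H}}=1$, and $\Psi\otimes\Psi$ denotes the operator $\varphi\mapsto\langle\varphi,\Psi\rangle_{\mathcal{H}}\,\Psi$.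
   Formalization: The decomposition is stated for pairs of densities with zero mean on each circle; on all of L²×L² it fails, since every Ψ has zero mean on each circle while K* halves the mean of a density on each circle (extra eigenvalue 1/2). *)

(* Defs.v *)
From HB Require Import structures.
From mathcomp Require Import all_boot all_order all_algebra finmap ring lra.
From mathcomp Require Import complex.
From mathcomp Require Import all_classical all_reals all_analysis.

Set Implicit Arguments.
Unset Strict Implicit.
Unset Printing Implicit Defensive.

Import Order.TTheory GRing.Theory Num.Theory.
Import numFieldNormedType.Exports.

Local Open Scope classical_set_scope.
Local Open Scope ring_scope.
Local Open Scope complex_scope.

Section Hyperbolic.
Context {R : realType}.
Implicit Types x t : R.

Definition cosh x : R := (expR x + expR (- x)) / 2.
Definition sinh x : R := (expR x - expR (- x)) / 2.
Definition asinh x : R := ln (x + Num.sqrt (x ^+ 2 + 1)).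

Lemma cosh2E x : cosh x ^+ 2 = 1 + sinh x ^+ 2.
Proof.
rewrite /cosh /sinh expRN.
have : expR x != 0 by rewrite gt_eqF ?expR_gt0.
by move=> e0; field.
Qed.

Lemma coshN x : cosh (- x) = cosh x.
Proof. by rewrite /cosh opprK addrC. Qed.

Lemma sinhN x : sinh (- x) = - sinh x.
Proof. by rewrite /sinh opprK -opprB mulNr. Qed.

Lemma cosh_gt0 x : 0 < cosh x.
Proof. by rewrite divr_gt0// addr_gt0// expR_gt0. Qed.

Lemma asinhK : cancel asinh sinh.
Proof.
move=> x; rewrite /asinh /sinh.
set s := Num.sqrt _.
have s2 : s ^+ 2 = x ^+ 2 + 1 by rewrite sqr_sqrtr// addr_ge0// sqr_ge0.
have s0 : 0 <= s by exact: sqrtr_ge0.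
have xs : 0 < x + s by nra.
rewrite expRN lnK ?posrE//.
have n0 : x + s != 0 by rewrite gt_eqF.
apply/eqP; rewrite -subr_eq0.
have -> : (x + s - (x + s)^-1) / 2 - x
  = (s ^+ 2 - (x ^+ 2 + 1)) / (2 * (x + s)) by field.
by rewrite s2 subrr mul0r.
Qed.

End Hyperbolic.

Section Integration.
Context {R : realType}.

Definition angles : set R := [set` `]- pi, pi]].

Definition cintegral (f : R -> R[i]) : R[i] :=
  (\int[lebesgue_measure]_(t in angles) complex.Re (f t))
  +i* (\int[lebesgue_measure]_(t in angles) complex.Im (f t)).

Definition normc2 (z : R[i]) : R := complex.Re z ^+ 2 + complex.Im z ^+ 2.

Definition expi (x : R) : R[i] := cos x +i* sin x.

Definition dot2 (u v : R * R) : R := u.1 * v.1 + u.2 * v.2.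
Definition enorm (u : R * R) : R := Num.sqrt (dot2 u u).

(* Componentwise, as R[i] is not equipped with a normed R-module structure. *)
Definition cderive (u : R * R -> R[i]) (v x : R * R) : R[i] :=
  ('D_v (fun y => complex.Re (u y)) x) +i* ('D_v (fun y => complex.Im (u y)) x).

End Integration.

Section TwoDisks.
Context {R : realType}.
Variables r eps : R.

(* The index j : 'I_2 stands for the disk B_(j+1): ord0 is B_1, in x < 0. *)
Definition center (j : 'I_2) : R * R := ((-1) ^+ j.+1 * (r + eps / 2), 0).
Definition circle (j : 'I_2) : set (R * R) :=
  [set x | enorm (x - center j) = r].
Definition normal (j : 'I_2) (x : R * R) : R * R := r^-1 *: (x - center j).

Definition alpha : R := Num.sqrt (eps * (r + eps / 4)).
Definition xi0 : R := asinh (alpha / r).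
Definition bipolar (xi t : R) : R * R :=
  (alpha * (sinh xi / (cosh xi - cos t)), alpha * (sin t / (cosh xi - cos t))).
Definition h (xi t : R) : R := (cosh xi - cos t) / alpha.
Definition bdry (j : 'I_2) (t : R) : R * R := bipolar ((-1) ^+ j.+1 * xi0) t.

(* Line integral over the boundary of either disk, the arc length element
   being d sigma = dt / h xi0 t: see bdry_circle and bdry_line_element. *)
Definition lineint (f : R -> R[i]) : R[i] :=
  cintegral (fun t => f t * ((h xi0 t)^-1)%:C).

(* Pairs of functions on the two circles, as functions of the bipolar angle;
   only the values at angles in ]-pi, pi] matter. *)
Definition density := 'I_2 -> R -> R[i].
Implicit Types phi psi : density.

Definition ldot phi psi : R[i] :=
  \sum_(j < 2) lineint (fun t => phi j t * (psi j t)^*).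

Definition L2norm2 phi : \bar R :=
  (\sum_(j < 2) \int[lebesgue_measure]_(t in angles)
     (normc2 (phi j t) / h xi0 t)%:E)%E.

Definition in_L2 phi : Prop :=
  (forall j, measurable_fun angles (fun t => complex.Re (phi j t)) /\
             measurable_fun angles (fun t => complex.Im (phi j t))) /\
  (L2norm2 phi < +oo)%E.

(* Zero mean on each of the two circles: the subspace on which Hdot is positive
   definite, and outside which npop has the further eigenvalue 1/2. *)
Definition in_L20 phi : Prop :=
  in_L2 phi /\ forall j, lineint (phi j) = 0.

Definition slp (j : 'I_2) (f : R -> R[i]) (x : R * R) : R[i] :=
  ((2 * pi)^-1)%:C * lineint (fun t => (ln (enorm (x - bdry j t)))%:C * f t).

(* The kernel is 0 at the single t with bdry j t = x. *)
Definition npdisk (j : 'I_2) (f : R -> R[i]) (x : R * R) : R[i] :=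
  ((2 * pi)^-1)%:C * lineint (fun t =>
    (dot2 (x - bdry j t) (normal j x) / enorm (x - bdry j t) ^+ 2)%:C * f t).

Definition npop phi : density := fun i t =>
  let x := bdry i t in
  \sum_(j < 2) if j == i then npdisk i (phi i) x
               else cderive (slp j (phi j)) (normal i x) x.

Definition slop phi : density := fun i t =>
  \sum_(j < 2) slp j (phi j) (bdry i t).

Definition Hdot phi psi : R[i] := - ldot phi (slop psi).

Definition tensor psi phi : density := fun j t => Hdot phi psi * psi j t.

(* The sign + is encoded by s = false and the sign - by s = true. *)
Definition Psi (s : bool) (n : int) : density := fun j t =>
  (Num.sqrt `|n|%:~R / Num.sqrt
     (2 * pi * (1 - (-1) ^+ s * expR (- (2 * `|n|%:~R * xi0)))))%:C
  * expi (n%:~R * t)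
  * (if j == ord0 then h (- xi0) t else - ((-1) ^+ s * h xi0 t))%:C.

Definition eigval (s : bool) (n : int) : R :=
  (-1) ^+ s * (2^-1 * expR (- (2 * `|n|%:~R * xi0))).

Definition partial_sum (s : bool) (A : {fset int}) phi : density := fun j t =>
  \sum_(n <- A | n != 0) (eigval s n)%:C * tensor (Psi s n) phi j t.

End TwoDisks.

Section Geometry.
Context {R : realType}.
Variables r eps : R.
Hypotheses (hr : 0 < r) (heps : 0 < eps).

Let al := alpha r eps.
Let C := cosh (xi0 r eps).
Let S := sinh (xi0 r eps).

Let alpha_gt0 : 0 < al.
Proof. rewrite sqrtr_gt0 mulr_gt0 //. rewrite addr_gt0 // divr_gt0 //. Qed.

Let sinhE : S = al / r.
Proof. exact: asinhK. Qed.

Let coshE : C = (r + eps / 2) / r.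
Proof.
have C0 : 0 < C by exact: cosh_gt0.
move: hr heps => r0 e0.
have a2 : al ^+ 2 = eps * (r + eps / 4) by rewrite sqr_sqrtr// mulr_ge0//; lra.
apply/eqP; rewrite -(@eqrXn2 _ 2)//; [|exact: ltW|by rewrite divr_ge0//; lra].
rewrite /C cosh2E -/S sinhE expr_div_n a2; apply/eqP.
by field; rewrite gt_eqF.
Qed.

Let C_gt_cos t : 0 < C - cos t.
Proof.
move: hr heps => r0 e0; have : 1 < C by rewrite coshE ltr_pdivlMr//; lra.
by have := cos_le1 t; lra.
Qed.

Let cosh_sgn (j : 'I_2) : cosh ((-1) ^+ j.+1 * xi0 r eps) = C.
Proof. by rewrite -signr_odd; case: odd; rewrite ?mulN1r ?coshN ?mul1r. Qed.

Let sinh_sgn (j : 'I_2) :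
  sinh ((-1) ^+ j.+1 * xi0 r eps) = (-1) ^+ j.+1 * S.
Proof. by rewrite -signr_odd; case: odd; rewrite ?mulN1r ?sinhN ?mul1r. Qed.

Let cos_sin_surj (a b : R) : a ^+ 2 + b ^+ 2 = 1 ->
  exists2 t, t \in (`]- pi, pi] : interval R) & cos t = a /\ sin t = b.
Proof.
move=> ab; have a1 : -1 <= a <= 1 by apply/andP; split; nra.
have ac : cos (acos a) = a by rewrite acosK// in_itv.
have sac : sin (acos a) = `|b|.
  by rewrite sin_acos// -ab addrAC subrr add0r sqrtr_sqr.
have p0 := pi_gt0 R.
have a0 := acos_ge0 a1.
have api := acos_lepi a1.
have [b0|b0] := leP 0 b.
- exists (acos a); first by rewrite in_itv/= api andbT; lra.
  by rewrite ac sac ger0_norm.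
- exists (- acos a); last by rewrite cosN sinN ac sac ltr0_norm ?opprK.
  have aNpi : acos a != pi.
    apply/eqP => E; move: sac; rewrite E sinpi => /esym/eqP.
    by rewrite normr_eq0 lt_eqF.
  have : acos a < pi by rewrite lt_neqAle aNpi.
  by move=> H; rewrite in_itv/=; apply/andP; split; lra.
Qed.

Lemma bdry_circle (j : 'I_2) : bdry r eps j @` angles = circle r eps j.
Proof.
move: hr heps => rp ep; have r0 : r != 0 by rewrite gt_eqF.
have aE : al = r * S by rewrite sinhE; field.
have cE : r + eps / 2 = r * C by rewrite coshE; field.
have CS : C ^+ 2 = 1 + S ^+ 2 by exact: cosh2E.
have S0 : 0 < S by rewrite sinhE divr_gt0.
have s2 : ((-1) ^+ j.+1) ^+ 2 = 1 :> R by rewrite sqrr_sign.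
rewrite /bdry /circle /center /bipolar /enorm /dot2 -/al.
rewrite cosh_sgn sinh_sgn cE aE; move: s2; set s : R := _ ^+ j.+1 => s2.
apply/seteqP; split=> [_ [t _ <-]|[x y]] /=.
- rewrite -[RHS]ger0_norm ?ltW// -sqrtr_sqr; congr Num.sqrt.
  have D0 : C - cos t != 0 by rewrite gt_eqF.
  have sc : sin t ^+ 2 = 1 - cos t ^+ 2 by rewrite sin2cos2.
  have -> : (r * S * (s * S / (C - cos t)) - s * (r * C)) *
     (r * S * (s * S / (C - cos t)) - s * (r * C)) +
     (r * S * (sin t / (C - cos t)) - 0) * (r * S * (sin t / (C - cos t)) - 0)
   = (s ^+ 2 * (r * S ^+ 2 - r * C * (C - cos t)) ^+ 2
      + r ^+ 2 * S ^+ 2 * sin t ^+ 2) / (C - cos t) ^+ 2 by field.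
  have S2 : S ^+ 2 = C ^+ 2 - 1 by rewrite CS; ring.
  by rewrite s2 sc S2; field.
- rewrite subr0 -!expr2 => E.
  have E2 : (x - s * (r * C)) ^+ 2 + y ^+ 2 = r ^+ 2.
    by rewrite -[in RHS]E sqr_sqrtr// addr_ge0// sqr_ge0.
  have [u ux] : exists u, x = s * u.
    by exists (s * x); rewrite mulrA -expr2 s2 mul1r.
  subst x.
  have E3 : y ^+ 2 = r ^+ 2 - (u - r * C) ^+ 2.
    rewrite -E2 -mulrBr exprMn s2 mul1r; ring.
  have C1 : 1 < C by rewrite coshE ltr_pdivlMr//; lra.
  have u0 : 0 < u.
    rewrite ltNge; apply/negP => u0.
    have : 0 <= y ^+ 2 by exact: sqr_ge0.
    have : r < r * C by nra.
    by rewrite E3; nra.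
  have un0 : u != 0 by rewrite gt_eqF.
  have Sn0 : S != 0 by rewrite gt_eqF.
  have [|t tI [ct st]] := @cos_sin_surj (C - r * S ^+ 2 / u) (y * S / u).
    have -> : (C - r * S ^+ 2 / u) ^+ 2 + (y * S / u) ^+ 2
      = ((u * C - r * S ^+ 2) ^+ 2 + y ^+ 2 * S ^+ 2) / u ^+ 2 by field.
    have S2 : S ^+ 2 = C ^+ 2 - 1 by rewrite CS; ring.
    by rewrite E3 S2; field.
  exists t => //=; rewrite ct st.
  have -> : C - (C - r * S ^+ 2 / u) = r * S ^+ 2 / u by ring.
  by congr (_, _); field; rewrite un0 Sn0 r0.
Qed.

Lemma bdry_line_element (j : 'I_2) (t : R) :
  enorm (derive1 (fun u => (bdry r eps j u).1) t,
         derive1 (fun u => (bdry r eps j u).2) t)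
  = (h r eps (xi0 r eps) t)^-1.
Proof.
rewrite /bdry /bipolar /= -/al cosh_sgn sinh_sgn.
have s2 : ((-1) ^+ j.+1) ^+ 2 = 1 :> R by rewrite sqrr_sign.
move: s2; set s : R := _ ^+ j.+1 => s2.
have D0 : C - cos t != 0 by rewrite gt_eqF.
have CS : S ^+ 2 = C ^+ 2 - 1 by rewrite [C ^+ 2]cosh2E addrAC subrr add0r.
have dD : is_derive t 1 (fun u : R => C - cos u) (sin t).
  apply: is_derive_eq; by rewrite add0r mul1r opprK.
have dI : is_derive t 1 (fun u : R => (C - cos u)^-1)
    (- (C - cos t) ^- 2 * sin t).
  by have := @is_deriveV R (fun u => C - cos u) t (sin t) 1 D0 dD.
have -> : derive1 (fun u : R => al * (s * S / (C - cos u))) t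
    = al * (s * S) * (- (C - cos t) ^- 2 * sin t).
  rewrite (_ : (fun u : R => _) = (al * (s * S)) \*: (fun u : R => (C - cos u)^-1)); last first.
    by apply/funext => u /=; rewrite mulrA.
  by rewrite derive1E derive_val.
have -> : derive1 (fun u : R => al * (sin u / (C - cos u))) t
    = al * (cos t / (C - cos t) - sin t ^+ 2 * (C - cos t) ^- 2).
  rewrite (_ : (fun u : R => _) = al \*: ((@sin R) * (fun u : R => (C - cos u)^-1))); last first.
    by apply/funext => u.
  rewrite derive1E derive_val /GRing.scale /=; field.
  exact: D0.
rewrite /enorm /dot2 /= /h -/C -/al invf_div.
rewrite -[RHS]ger0_norm ?divr_ge0// ?ltW// -sqrtr_sqr; congr Num.sqrt.
have sc : sin t ^+ 2 = 1 - cos t ^+ 2 by rewrite sin2cos2.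
transitivity (al ^+ 2 * (s ^+ 2 * S ^+ 2 * sin t ^+ 2 +
   (cos t * (C - cos t) - sin t ^+ 2) ^+ 2) / (C - cos t) ^+ 4).
  by field.
by rewrite s2 CS sc; field.
Qed.

End Geometry.

(* Main.v *)
(* Write a density on the two circles as [phi j = h * f_j].  In bipolar
   coordinates [|x - y|^2] is [2 (cosh (xi - xi') - cos (theta - theta'))] up to
   a product of a function of [x] and a function of [y], so on densities of mean
   zero the single layer potentials become convolutions with [ln Q] and the
   off-diagonal entries of the Neumann-Poincare operator become [- h / (4 pi)]
   times convolution of [f_j] with the Poisson kernel [(1 - rho^2) / Q], where
   [Q(x) = 1 - 2 rho cos x + rho^2] and [rho = e^(-2 xi_0)]; the diagonal entries
   have the constant kernel [1 / (2 r)] and vanish.  The Fourier coefficients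
   [rho^|n|] and [- rho^|n| / |n|] of these two kernels give eigenvectors and
   norms.  For the logarithm at [rho = 1] (same circle) they are obtained by
   letting [rho] tend to 1.  As the Fourier series of the Poisson kernel
   converges uniformly, finite subsums of the spectral series approximate the
   operator in norm, by the sup norm of the remainder kernel and Cauchy-Schwarz. *)

Require Import Defs.
From mathcomp Require Import all_boot all_order all_algebra finmap ring lra.
From mathcomp Require Import complex.
From mathcomp Require Import all_classical all_reals all_analysis measurable_realfun.

Set Implicit Arguments.
Unset Strict Implicit.
Unset Printing Implicit Defensive.

Import Order.TTheory GRing.Theory Num.Theory.
Import numFieldNormedType.Exports.

Local Open Scope ring_scope.
Local Open Scope complex_scope.

(** * Complex-valued integrals over one period *)

(** The spectral series is read off the kernel of the operator. The normalization cancels: the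
    square of the constant in [Psi s n], times the factor produced by [Hdot], is 1 / (4 pi) for
    every nonzero [n]. Each spectral term is therefore an ordinary Fourier term of the Poisson
    kernel, applied to one of two sign combinations of the pair of densities. Adding both signs
    cancels the contribution of a circle to itself and doubles that of the other circle, which is
    the shape of the operator on mean zero densities.

    The logarithm of the distance also carries terms in [ln h]. Mean zero of the source density
    removes the one at the target point. The one at the source angle leaves a constant, which
    disappears only when paired with a second density of mean zero on each circle.

    On a single circle the formulas for the kernels fail at coincident points, where [ln] and
    division take default values, so they are compared away from one point. The logarithm is
    moreover unbounded there, hence has no uniform Fourier approximation, and its integrability has
    to be proved before any limit can be taken. *)

Section ComplexIntegral.
Context {R : realType}.
Implicit Types (z w : R[i]) (f g k : R -> R[i]) (M : R).

Local Open Scope classical_set_scope.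
Local Open Scope ring_scope.
Local Notation mu := (@lebesgue_measure R).
Local Notation A := (@angles R).
Local Notation Re := (@complex.Re R).
Local Notation Im := (@complex.Im R).

Lemma measurable_angles : measurable (A : set (measurableTypeR R)).
Proof. exact: measurable_itv. Qed.
Local Notation mA := measurable_angles.

Lemma angles_measure : mu A = (2 * pi)%:E.
Proof.
rewrite /angles lebesgue_measure_itv/= lte_fin gtrN ?pi_gt0//.
by rewrite -EFinD opprK mulr_natl mulr2n.
Qed.

Lemma ReD z w : Re (z + w) = Re z + Re w. Proof. by case: z; case: w. Qed.
Lemma ImD z w : Im (z + w) = Im z + Im w. Proof. by case: z; case: w. Qed.
Lemma ReN z : Re (- z) = - Re z. Proof. by case: z. Qed.
Lemma ImN z : Im (- z) = - Im z. Proof. by case: z. Qed.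
Lemma ReM z w : Re (z * w) = Re z * Re w - Im z * Im w.
Proof. by case: z; case: w. Qed.
Lemma ImM z w : Im (z * w) = Re z * Im w + Im z * Re w.
Proof. by case: z => a b; case: w => c d /=; rewrite [b * c]mulrC. Qed.
Lemma ReRM M z : Re (M%:C * z) = M * Re z.
Proof. by rewrite ReM/= mul0r subr0. Qed.
Lemma ImRM M z : Im (M%:C * z) = M * Im z.
Proof. by rewrite ImM/= mul0r addr0. Qed.

Lemma complexP z w : Re z = Re w -> Im z = Im w -> z = w.
Proof. by case: z => a b; case: w => c d /= -> ->. Qed.

(** The sum of the components suits [cintegral], which integrates them separately: estimates reduce
    to real ones. It is comparable with the modulus by [normc2_le_norm1] and [norm1_le_normc2]. *)
Definition norm1 z : R := `|Re z| + `|Im z|.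

Lemma norm1_ge0 z : 0 <= norm1 z.
Proof. by rewrite addr_ge0. Qed.

Lemma norm1_eq0 z : norm1 z <= 0 -> z = 0.
Proof.
move=> H; have := normr_ge0 (Re z); have := normr_ge0 (Im z).
rewrite /norm1 in H => i0 r0.
have /normr0_eq0 rz : `|Re z| = 0 by lra.
have /normr0_eq0 iz : `|Im z| = 0 by lra.
exact: complexP.
Qed.

Lemma norm1D z w : norm1 (z + w) <= norm1 z + norm1 w.
Proof.
rewrite /norm1 ReD ImD.
have := ler_normD (Re z) (Re w); have := ler_normD (Im z) (Im w); lra.
Qed.

Lemma norm1N z : norm1 (- z) = norm1 z.
Proof. by rewrite /norm1 ReN ImN !normrN. Qed.

Lemma norm1RM M z : norm1 (M%:C * z) = `|M| * norm1 z.
Proof. by rewrite /norm1 ReRM ImRM !normrM mulrDr. Qed.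

Lemma norm1_real M : norm1 M%:C = `|M|.
Proof. by rewrite /norm1/= normr0 addr0. Qed.

Lemma norm1M z w : norm1 (z * w) <= norm1 z * norm1 w.
Proof.
rewrite /norm1 ReM ImM.
have := ler_normB (Re z * Re w) (Im z * Im w).
have := ler_normD (Re z * Im w) (Im z * Re w).
rewrite !normrM; lra.
Qed.

Lemma norm1_sum (I : eqType) (s : seq I) (F : I -> R[i]) :
  norm1 (\sum_(i <- s) F i) <= \sum_(i <- s) norm1 (F i).
Proof.
elim: s => [|i s IH]; first by rewrite !big_nil norm1_real normr0.
by rewrite !big_cons (le_trans (norm1D _ _))// lerD2l.
Qed.

Lemma normc2_le_norm1 z : normc2 z <= norm1 z ^+ 2.
Proof.
rewrite /normc2 /norm1 -[Re z ^+ 2]real_normK ?num_real//.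
rewrite -[Im z ^+ 2]real_normK ?num_real//.
have := normr_ge0 (Re z); have := normr_ge0 (Im z); nra.
Qed.

Lemma norm1_le_normc2 z : norm1 z ^+ 2 <= 2 * normc2 z.
Proof.
rewrite /normc2 /norm1 -[Re z ^+ 2]real_normK ?num_real//.
rewrite -[Im z ^+ 2]real_normK ?num_real//.
have := sqr_ge0 (`|Re z| - `|Im z|); nra.
Qed.

Lemma normc2_ge0 z : 0 <= normc2 z.
Proof. by rewrite addr_ge0// sqr_ge0. Qed.

Definition cmeasurable f :=
  measurable_fun A (Re \o f) /\ measurable_fun A (Im \o f).

Definition rintegrable (f : R -> R) := mu.-integrable A (EFin \o f).

Definition cintegrable f := rintegrable (Re \o f) /\ rintegrable (Im \o f).

Lemma rintegrable_measurable (f : R -> R) :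
  rintegrable f -> measurable_fun A f.
Proof. by move/(measurable_int mu)/measurable_EFinP. Qed.

Lemma rintegrable_le (f g : R -> R) : measurable_fun A f ->
  (forall t, A t -> `|f t| <= g t) -> rintegrable g -> rintegrable f.
Proof.
move=> mf fg ig; rewrite /rintegrable; apply: le_integrable ig => //.
  exact: mA.
  exact/measurable_EFinP.
by move=> t /fg H /=; rewrite lee_fin (le_trans H)// ler_norm.
Qed.

Lemma eq_rintegrable (f g : R -> R) : (forall t, A t -> f t = g t) ->
  rintegrable f -> rintegrable g.
Proof.
rewrite /rintegrable => fg; apply: eq_integrable => [|t /set_mem /fg /= ->//].
exact: mA.
Qed.

Lemma rintegrableD (f g : R -> R) :
  rintegrable f -> rintegrable g -> rintegrable (fun t => f t + g t).
Proof. by rewrite /rintegrable => i j; exact: (integrableD mA i j). Qed.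

Lemma rintegrableZ M (f : R -> R) :
  rintegrable f -> rintegrable (fun t => M * f t).
Proof. by rewrite /rintegrable => i; exact: (integrableZl mA M i). Qed.

Lemma rintegrable_norm (f : R -> R) :
  rintegrable f -> rintegrable (fun t => `|f t|).
Proof. by rewrite /rintegrable => i; exact: (integrable_norm i). Qed.

Lemma rintegrable_bounded M (f : R -> R) : measurable_fun A f ->
  (forall t, A t -> `|f t| <= M) -> rintegrable f.
Proof.
move=> mf fM; apply: (measurable_bounded_integrable mA) => //.
  by have := angles_measure; rewrite /= => ->; rewrite ltry.
exists M; split; rewrite ?num_real// => x Mx t /= /fM H.
exact: le_trans (ltW Mx).
Qed.

Lemma rintegrable_cst M : rintegrable (fun=> M).
Proof. exact: (@rintegrable_bounded `|M|). Qed.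

Lemma Rintegral_angles_cst M : \int[mu]_(t in A) M = M * (2 * pi).
Proof.
rewrite Rintegral_cst; last exact: mA.
by have := angles_measure; rewrite /= => ->.
Qed.

Lemma cintegrable_measurable f : cintegrable f -> cmeasurable f.
Proof. by move=> [] /rintegrable_measurable + /rintegrable_measurable. Qed.

Lemma norm1_integrable f : cintegrable f -> rintegrable (norm1 \o f).
Proof.
by move=> [i j]; exact: (rintegrableD (rintegrable_norm i) (rintegrable_norm j)).
Qed.

Lemma cmeasurableM f g : cmeasurable f -> cmeasurable g ->
  cmeasurable (fun t => f t * g t).
Proof.
move=> [a b] [c d]; split.
- rewrite (_ : _ \o _ = (Re \o f) \* (Re \o g) - ((Im \o f) \* (Im \o g))).
    by apply: measurable_funB; exact: measurable_funM.
  by apply/funext => t; rewrite /= ReM.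
- rewrite (_ : _ \o _ = (Re \o f) \* (Im \o g) + ((Im \o f) \* (Re \o g))).
    by apply: measurable_funD; exact: measurable_funM.
  by apply/funext => t; rewrite /= ImM.
Qed.

Lemma cmeasurable_cst z : cmeasurable (fun=> z).
Proof. by split; exact: measurable_cst. Qed.

Lemma cmeasurableD f g : cmeasurable f -> cmeasurable g ->
  cmeasurable (fun t => f t + g t).
Proof.
move=> [a b] [c d]; split.
- rewrite (_ : _ \o _ = (Re \o f) + (Re \o g)); first exact: measurable_funD.
  by apply/funext => t; rewrite /= ReD.
- rewrite (_ : _ \o _ = (Im \o f) + (Im \o g)); first exact: measurable_funD.
  by apply/funext => t; rewrite /= ImD.
Qed.

Lemma cmeasurableB f g : cmeasurable f -> cmeasurable g ->
  cmeasurable (fun t => f t - g t).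
Proof.
move=> mf mg; apply: cmeasurableD => //.
by under eq_fun do rewrite -mulN1r; apply: cmeasurableM => //; exact: cmeasurable_cst.
Qed.

Lemma cmeasurable_sum (I : Type) (r : seq I) (F : I -> R -> R[i]) :
  (forall i, cmeasurable (F i)) -> cmeasurable (fun t => \sum_(i <- r) F i t).
Proof.
move=> mF; elim: r => [|i r IH].
  by under eq_fun do rewrite big_nil; exact: cmeasurable_cst.
by under eq_fun do rewrite big_cons; exact: cmeasurableD.
Qed.

Lemma cintegrable_le f (g : R -> R) : cmeasurable f ->
  (forall t, A t -> norm1 (f t) <= g t) -> rintegrable g -> cintegrable f.
Proof.
move=> [a b] fg ig; split; apply: rintegrable_le ig => // t /fg;
  apply: le_trans; by rewrite /norm1 ?lerDl ?lerDr.
Qed.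

Lemma cintegrableMl M k f : cmeasurable k ->
  (forall t, A t -> norm1 (k t) <= M) -> cintegrable f ->
  cintegrable (fun t => k t * f t).
Proof.
move=> mk kM fi.
apply: (@cintegrable_le _ (fun t => M * norm1 (f t))).
- by apply: cmeasurableM => //; exact: cintegrable_measurable.
- move=> t /kM H; rewrite (le_trans (norm1M _ _))//.
  by rewrite ler_wpM2r ?norm1_ge0.
- by apply: rintegrableZ; exact: norm1_integrable.
Qed.

Lemma cmeasurableR (f : R -> R) :
  measurable_fun A f -> cmeasurable (fun t => (f t)%:C).
Proof. by move=> mf; split=> //; exact: measurable_cst. Qed.

Lemma cintegrable_bounded M f : cmeasurable f ->
  (forall t, A t -> norm1 (f t) <= M) -> cintegrable f.
Proof. by move=> mf fM; apply: (cintegrable_le mf fM); exact: rintegrable_cst. Qed.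

Lemma cintegrableZ z f : cintegrable f -> cintegrable (fun t => z * f t).
Proof. by apply: (@cintegrableMl (norm1 z)) => //; exact: cmeasurable_cst. Qed.

Lemma cintegrableD f g : cintegrable f -> cintegrable g ->
  cintegrable (fun t => f t + g t).
Proof.
move=> [a b] [c d]; split.
- by apply: eq_rintegrable (rintegrableD a c) => t _; rewrite /= ReD.
- by apply: eq_rintegrable (rintegrableD b d) => t _; rewrite /= ImD.
Qed.

Lemma cintegrable0 : cintegrable (fun=> 0).
Proof. by split; exact: rintegrable_cst. Qed.

Lemma cintegrable_sum (I : Type) (s : seq I) (F : I -> R -> R[i]) :
  (forall i, cintegrable (F i)) -> cintegrable (fun t => \sum_(i <- s) F i t).
Proof.
move=> iF; elim: s => [|i s IH].
  by under eq_fun do rewrite big_nil; exact: cintegrable0.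
by under eq_fun do rewrite big_cons; exact: cintegrableD.
Qed.

Lemma eq_cintegral f g : (forall t, A t -> f t = g t) ->
  cintegral f = cintegral g.
Proof.
move=> fg; rewrite /cintegral; congr (_ +i* _);
by apply: eq_Rintegral => t /set_mem /fg ->.
Qed.

Lemma cintegralD f g : cintegrable f -> cintegrable g ->
  cintegral (fun t => f t + g t) = cintegral f + cintegral g.
Proof.
move=> [a b] [c d]; rewrite /cintegral; apply: complexP; rewrite ?ReD ?ImD/=.
- by under eq_Rintegral do rewrite ReD; rewrite RintegralD//; exact: mA.
- by under eq_Rintegral do rewrite ImD; rewrite RintegralD//; exact: mA.
Qed.

Lemma cintegral0 : cintegral (fun=> 0) = 0 :> R[i].
Proof.
by apply: complexP; rewrite /= Rintegral_angles_cst mul0r.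
Qed.

Lemma cintegralZ z f : cintegrable f ->
  cintegral (fun t => z * f t) = z * cintegral f.
Proof.
move=> [a b].
have Z x (h : R -> R) : rintegrable h ->
    \int[mu]_(t in A) (x * h t) = x * \int[mu]_(t in A) h t.
  by move=> ih; rewrite RintegralZl//; exact: mA.
have iZ x (h : R -> R) : rintegrable h ->
    mu.-integrable A (EFin \o (fun t => x * h t)) by exact: rintegrableZ.
rewrite /cintegral; apply: complexP; rewrite ?ReM ?ImM/=.
- under eq_Rintegral do rewrite ReM.
  by rewrite RintegralB ?Z//; [exact: mA|exact: iZ|exact: iZ].
- under eq_Rintegral do rewrite ImM.
  by rewrite RintegralD ?Z//; [exact: mA|exact: iZ|exact: iZ].
Qed.

Lemma cintegralN f : cintegrable f ->
  cintegral (fun t => - f t) = - cintegral f.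
Proof.
by move=> fi; under eq_fun do rewrite -mulN1r; rewrite cintegralZ// mulN1r.
Qed.

Lemma cintegral_sum (I : Type) (s : seq I) (F : I -> R -> R[i]) :
  (forall i, cintegrable (F i)) ->
  cintegral (fun t => \sum_(i <- s) F i t) = \sum_(i <- s) cintegral (F i).
Proof.
move=> iF; elim: s => [|i s IH].
  by under eq_fun do rewrite big_nil; rewrite big_nil cintegral0.
under eq_fun do rewrite big_cons.
by rewrite big_cons cintegralD ?IH//; exact: cintegrable_sum.
Qed.

Definition L1norm f : R := \int[mu]_(t in A) norm1 (f t).

Lemma norm1_cintegral f : cintegrable f -> norm1 (cintegral f) <= L1norm f.
Proof.
move=> [a b]; rewrite /L1norm /norm1 /cintegral/=.
rewrite RintegralD; [|exact: mA|exact: rintegrable_norm|exact: rintegrable_norm].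
by rewrite lerD// le_normr_Rintegral//; exact: mA.
Qed.

Lemma norm1_cintegralMl M k f : cmeasurable k ->
  (forall t, A t -> norm1 (k t) <= M) -> cintegrable f ->
  norm1 (cintegral (fun t => k t * f t)) <= M * L1norm f.
Proof.
move=> mk kM fi.
have kfi := cintegrableMl mk kM fi.
rewrite (le_trans (norm1_cintegral kfi))//.
rewrite /L1norm -RintegralZl; [|exact: mA|exact: norm1_integrable].
apply: le_Rintegral.
- exact: mA.
- exact: norm1_integrable.
- by apply: rintegrableZ; exact: norm1_integrable.
- move=> t /kM H; rewrite (le_trans (norm1M _ _))//.
  by rewrite ler_wpM2r ?norm1_ge0.
Qed.

End ComplexIntegral.

(** * Exponentials and their orthogonality *)

Section Expi.
Context {R : realType}.
Implicit Types (x y t : R) (n m : int).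

Local Open Scope classical_set_scope.
Local Open Scope ring_scope.
Local Notation mu := (@lebesgue_measure R).
Local Notation A := (@angles R).

Lemma expiD x y : expi (x + y) = expi x * expi y.
Proof.
rewrite /expi cosD sinD; apply: complexP => //=.
by rewrite addrC.
Qed.

Lemma expi0 : expi 0 = 1 :> R[i].
Proof. by rewrite /expi cos0 sin0. Qed.

Lemma conj_expi x : (expi x)^* = expi (- x).
Proof. by rewrite /expi cosN sinN. Qed.

Lemma norm1_expi x : norm1 (expi x) <= 2.
Proof.
rewrite /norm1/= -[2]/(1 + 1) lerD// ler_norml.
- by rewrite cos_geN1 cos_le1.
- by rewrite sin_geN1 sin_le1.
Qed.

Lemma expi_cos x : (2 * cos x)%:C = expi x + expi (- x).
Proof.
rewrite /expi cosN sinN; apply: complexP => /=; last by rewrite subrr.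
by rewrite mulr_natl mulr2n.
Qed.

Lemma cmeasurable_expi (f : R -> R) :
  measurable_fun A f -> cmeasurable (fun t => expi (f t)).
Proof.
move=> mf; split.
- have mg : measurable_fun [set: R] (@cos R).
    by apply: continuous_measurable_fun; exact: continuous_cos.
  exact: (measurableT_comp mg mf).
- have mg : measurable_fun [set: R] (@sin R).
    by apply: continuous_measurable_fun; exact: continuous_sin.
  exact: (measurableT_comp mg mf).
Qed.

Lemma angles_FTC (F f : R -> R) :
  (forall x, is_derive x 1 F (f x)) -> continuous f ->
  \int[mu]_(t in A) f t = F pi - F (- pi).
Proof.
move=> dF cf; rewrite /angles Rintegral_itv_obnd_cbnd; last first.
  apply: (@integrableS _ _ _ mu `[(-pi)%R, pi]%classic) => //.
    by apply: subset_itvr; rewrite bnd_simp.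
  apply: continuous_compact_integrable; first exact: segment_compact.
  exact: continuous_subspaceT.
have cF : continuous F.
  by move=> x; apply/differentiable_continuous/derivable1_diffP; exact: ex_derive.
rewrite /Rintegral (@continuous_FTC2 _ f F)//.
- by rewrite gtrN ?pi_gt0.
- exact: continuous_subspaceT.
- split.
  + by move=> x _; exact: ex_derive.
  + by apply: cvg_at_right_filter; exact: cF.
  + by apply: cvg_at_left_filter; exact: cF.
- by move=> x _; rewrite derive1E derive_val.
Qed.

Lemma sin_natpi (k : nat) : sin (k%:R * pi) = 0 :> R.
Proof.
elim: k => [|k IH]; first by rewrite mul0r sin0.
by rewrite -natr1 mulrDl mul1r sinDpi IH oppr0.
Qed.

Lemma sin_intpi n : sin (n%:~R * pi) = 0 :> R.
Proof.
case: n => k; first exact: sin_natpi.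
by rewrite NegzE rmorphN/= mulNr sinN sin_natpi oppr0.
Qed.

Lemma cintegral_expi n :
  cintegral (fun t => expi (n%:~R * t)) = (2 * pi * (n == 0)%:R)%:C :> R[i].
Proof.
have [->|n0] := eqVneq n 0.
  rewrite (@eq_cintegral _ _ (fun=> 1)); last by move=> t _; rewrite mul0r expi0.
  by apply: complexP; rewrite /= Rintegral_angles_cst ?mul0r ?mul1r ?mulr1.
have nR : (n%:~R : R) != 0 by rewrite intr_eq0.
have cM : continuous (fun t : R => n%:~R * t).
  by move=> x; apply: cvgM; [exact: cvg_cst|exact: cvg_id].
have dC (x : R) : is_derive x 1 (fun t => n%:~R^-1 * sin (n%:~R * t)) (cos (n%:~R * x)).
  by apply: is_derive_eq; rewrite /GRing.scale/= mulr1; field.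
have dS (x : R) : is_derive x 1 (fun t => - n%:~R^-1 * cos (n%:~R * t)) (sin (n%:~R * x)).
  by apply: is_derive_eq; rewrite /GRing.scale/= mulr1; field.
rewrite mulr0; apply: complexP => /=.
- rewrite (angles_FTC dC); last first.
    by move=> x; apply: continuous_comp; [exact: cM|exact: continuous_cos].
  by rewrite mulrN sinN sin_intpi oppr0 mulr0 subrr.
- rewrite (angles_FTC dS); last first.
    by move=> x; apply: continuous_comp; [exact: cM|exact: continuous_sin].
  by rewrite mulrN cosN subrr.
Qed.

End Expi.

(** * Kernels given by Fourier series *)

Section FourierKernel.
Context {R : realType}.
Implicit Types (x y t : R) (m n : int) (w : int -> R) (s : seq int).
Implicit Types (k : R -> R) (f : R -> R[i]) (T : nat -> R).

Local Open Scope classical_set_scope.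
Local Open Scope ring_scope.
Local Notation mu := (@lebesgue_measure R).
Local Notation A := (@angles R).

(** Enumerated as 0, ..., N and then -1, ..., -N, so that [p.+1] and [Negz p] pair up into a cosine
    in [trigpoly_cos]. *)
Definition ints (N : nat) : seq int :=
  [seq p%:Z | p <- iota 0 N.+1] ++ [seq Negz p | p <- iota 0 N].

Lemma mem_ints N n : (n \in ints N) = (`|n| <= N)%N.
Proof.
rewrite mem_cat; case: n => p.
- rewrite [X in _ || X](_ : _ = false); last by apply/negbTE/mapP => -[].
  by rewrite orbF mem_map ?mem_iota// => a b [].
- rewrite [X in X || _](_ : _ = false); last by apply/negbTE/mapP => -[].
  by rewrite mem_map ?mem_iota// => a b [].
Qed.

Lemma ints_uniq N : uniq (ints N).
Proof.
rewrite cat_uniq !map_inj_uniq ?iota_uniq ?andbT/=; try by move=> a b [].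
by apply/hasPn => _ /mapP[p _ ->]; apply/mapP => -[].
Qed.

Definition trigpoly w s x : R[i] := \sum_(n <- s) (w n)%:C * expi (n%:~R * x).

Lemma trigpoly_cos w N x : (forall n, w (- n) = w n) ->
  trigpoly w (ints N) x =
  (w 0 + \sum_(0 <= p < N) w p.+1 * (2 * cos (p.+1%:R * x)))%:C.
Proof.
move=> wN; rewrite /trigpoly /ints big_cat !big_map/= big_cons/= mul0r expi0.
rewrite mulr1 -addrA rmorphD/=; congr (_ + _).
rewrite (iotaDl 1 0 N) big_map rmorph_sum/= /index_iota subn0 -big_split/=.
apply: eq_bigr => p _; rewrite add1n rmorphM/= expi_cos mulrDr NegzE wN.
by rewrite rmorphN/= mulNr.
Qed.

Definition fourier_coef f n := cintegral (fun t => f t * expi (- (n%:~R * t))).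

Lemma measurable_affine (a b : R) (D : set R) :
  measurable_fun D (fun t => a * t + b).
Proof.
apply: measurable_funTS; apply: continuous_measurable_fun => x.
by apply: cvgD; [apply: cvgM; [exact: cvg_cst|exact: cvg_id]|exact: cvg_cst].
Qed.

Lemma cmeasurable_expiZ (a : R) : cmeasurable (fun t => expi (a * t)).
Proof.
apply: cmeasurable_expi.
rewrite (_ : *%R a = fun t => a * t + 0); first exact: measurable_affine.
by apply/funext => t; rewrite addr0.
Qed.

Lemma cmeasurable_trigpoly w s (a b : R) :
  cmeasurable (fun t => trigpoly w s (a * t + b)).
Proof.
apply: cmeasurable_sum => n; apply: cmeasurableM; first exact: cmeasurable_cst.
apply: cmeasurable_expi; under eq_fun do rewrite mulrDr mulrA.
exact: measurable_affine.
Qed.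

Lemma cmeasurable_trigpolyB w s x : cmeasurable (fun t => trigpoly w s (x - t)).
Proof.
under eq_fun do rewrite addrC -mulN1r.
exact: cmeasurable_trigpoly.
Qed.

Lemma norm1_trigpoly w s x : norm1 (trigpoly w s x) <= \sum_(n <- s) `|w n| * 2.
Proof.
rewrite (le_trans (norm1_sum _ _))//; apply: ler_sum => n _.
by rewrite norm1RM ler_wpM2l// norm1_expi.
Qed.

Lemma cintegrable_coef f n : cintegrable f ->
  cintegrable (fun t => f t * expi (- (n%:~R * t))).
Proof.
move=> fi; under eq_fun do rewrite mulrC; apply: (@cintegrableMl _ 2) => //.
- by under eq_fun do rewrite -mulNr; exact: cmeasurable_expiZ.
- by move=> t _; exact: norm1_expi.
Qed.

Lemma cintegrable_expi (a : R) : cintegrable (fun t => expi (a * t)).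
Proof.
apply: (@cintegrable_bounded _ 2); first exact: cmeasurable_expiZ.
by move=> t _; exact: norm1_expi.
Qed.

Lemma fourier_coef_expi n m :
  fourier_coef (fun t => expi (n%:~R * t)) m = (2 * pi * (m == n)%:R)%:C.
Proof.
rewrite /fourier_coef; under eq_fun do rewrite -expiD -mulNr -mulrDl.
rewrite (_ : n%:~R + - m%:~R = (n - m)%:~R); last by rewrite intrB.
by rewrite cintegral_expi subr_eq0 eq_sym.
Qed.

Lemma cintegral_trigpoly w s f x : cintegrable f ->
  cintegral (fun t => trigpoly w s (x - t) * f t) =
  \sum_(n <- s) (w n)%:C * expi (n%:~R * x) * fourier_coef f n.
Proof.
move=> fi; transitivity (cintegral (fun t =>
   \sum_(n <- s) (w n)%:C * expi (n%:~R * x) * (f t * expi (- (n%:~R * t))))).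
  apply: eq_cintegral => t _; rewrite /trigpoly mulr_suml; apply: eq_bigr => n _.
  by rewrite mulrBr expiD mulrA -[LHS]mulrA [_ * f t]mulrC.
rewrite cintegral_sum => [|n]; last exact/cintegrableZ/cintegrable_coef.
by apply: eq_bigr => n _; rewrite cintegralZ//; exact: cintegrable_coef.
Qed.

(** Uniform approximation by symmetric partial sums at an explicit rate [T]. By [kernel_expi] this
    forces [w] to be the Fourier coefficients of [k]. *)
Definition fourier_kernel k w T := [/\ measurable_fun setT k,
  T N @[N --> \oo] --> (0 : R) &
  forall N x, norm1 ((k x)%:C - trigpoly w (ints N) x) <= T N].

(** The bound is asked for large [N] only: in [kernel_expi] it holds once the frequency lies in
    [ints N]. *)
Lemma norm1_cvg0 (z : R[i]) T (C : R) : T N @[N --> \oo] --> (0 : R) ->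
  (\forall N \near \oo, norm1 z <= T N * C) -> z = 0.
Proof.
move=> T0 zT; apply: norm1_eq0.
have : (T N * C) @[N --> \oo] --> (0 * C) by apply: cvgMr_tmp.
by rewrite mul0r => H; rewrite -(cvg_lim _ H)//; apply: limr_ge => //; apply/cvg_ex; exists 0.
Qed.

Lemma fourier_kernel_bounded k w T : fourier_kernel k w T ->
  exists M, forall x, `|k x| <= M.
Proof.
move=> [_ _ H]; exists (T 0%N + \sum_(n <- ints 0) `|w n| * 2) => x.
rewrite -norm1_real -[X in norm1 X](subrK (trigpoly w (ints 0) x)).
by rewrite (le_trans (norm1D _ _))// lerD// norm1_trigpoly.
Qed.

Lemma cmeasurable_kernel k x : measurable_fun setT k ->
  cmeasurable (fun t => (k (x - t))%:C).
Proof.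
move=> mk; apply: cmeasurableR; apply: (measurableT_comp mk).
by under eq_fun do rewrite addrC -mulN1r; exact: measurable_affine.
Qed.

Lemma cintegrable_kernel k w T f x : fourier_kernel k w T -> cintegrable f ->
  cintegrable (fun t => (k (x - t))%:C * f t).
Proof.
move=> kw; have [mk _ _] := kw; have [M kM] := fourier_kernel_bounded kw.
apply: (@cintegrableMl _ M); first exact: cmeasurable_kernel.
by move=> t _; rewrite norm1_real.
Qed.

(** The list [s] is arbitrary: symmetric blocks give [kernel_approx], general finite sets of
    frequencies give unconditional convergence at the end. *)
Lemma norm1_kernel_trigpoly k w s f x (M : R) : measurable_fun setT k ->
  (forall y, norm1 ((k y)%:C - trigpoly w s y) <= M) -> cintegrable f ->
  cintegrable (fun t => (k (x - t))%:C * f t) ->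
  norm1 (cintegral (fun t => (k (x - t))%:C * f t) -
    \sum_(n <- s) (w n)%:C * expi (n%:~R * x) * fourier_coef f n) <=
  M * L1norm f.
Proof.
move=> mk kM fi kfi.
have mt := cmeasurable_trigpolyB w s x.
have ti : cintegrable (fun t => trigpoly w s (x - t) * f t).
  by apply: (cintegrableMl mt) => // t _; exact: norm1_trigpoly.
have mB : cmeasurable (fun t => (k (x - t))%:C - trigpoly w s (x - t)).
  by apply: cmeasurableB => //; exact: cmeasurable_kernel.
rewrite -cintegral_trigpoly// -cintegralN// -cintegralD//; last first.
  by under eq_fun do rewrite -mulN1r; exact: cintegrableZ.
under eq_cintegral do rewrite -mulNr -mulrDl.
by apply: norm1_cintegralMl.
Qed.

Lemma kernel_approx k w T f x N : fourier_kernel k w T -> cintegrable f ->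
  norm1 (cintegral (fun t => (k (x - t))%:C * f t) -
    \sum_(n <- ints N) (w n)%:C * expi (n%:~R * x) * fourier_coef f n) <=
  T N * L1norm f.
Proof.
move=> kw fi; have kfi := cintegrable_kernel x kw fi.
by case: kw => mk _ kT; exact: norm1_kernel_trigpoly.
Qed.

(** By orthogonality a single term of the partial sum survives as soon as [N] reaches the absolute
    value of [n], and the error tends to 0. *)
Lemma kernel_expi k w T n x : fourier_kernel k w T ->
  cintegral (fun t => (k (x - t))%:C * expi (n%:~R * t)) =
  (2 * pi * w n)%:C * expi (n%:~R * x).
Proof.
move=> kw; have [_ T0 _] := kw.
pose f t : R[i] := expi (n%:~R * t).
apply/eqP; rewrite -subr_eq0; apply/eqP.
apply: (@norm1_cvg0 _ T (L1norm f)) => //.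
near=> N; have nN : n \in ints N.
  by rewrite mem_ints; near: N; exact: nbhs_infty_ge.
have := kernel_approx x N kw (cintegrable_expi n%:~R).
rewrite (bigD1_seq n)//=; last exact: ints_uniq.
rewrite fourier_coef_expi eqxx mulr1 big1 => [|m mn].
  rewrite addr0 mulrC mulrA -rmorphM => H; exact: H.
by rewrite fourier_coef_expi (negbTE mn) mulr0 mulr0.
Unshelve. all: by end_near. Qed.

End FourierKernel.

(** * The Poisson kernel and its logarithmic primitive *)

Section PoissonKernel.
Context {R : realType}.
Implicit Types (x rho : R) (n : int) (N : nat).

Local Open Scope classical_set_scope.
Local Open Scope ring_scope.

(** This is |1 - rho e^(ix)|^2. *)
Definition qpol rho x : R := 1 - 2 * rho * cos x + rho ^+ 2.
Definition poisson rho x : R := (1 - rho ^+ 2) / qpol rho x.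
Definition log_qpol rho x : R := ln (qpol rho x).
Definition poisson_weight rho n : R := rho ^+ `|n|%N.
(** At [n = 0] the convention 0^-1 = 0 yields the weight 0, which is the correct mean of [ln Q]. *)
Definition log_weight rho n : R := - (rho ^+ `|n|%N / `|n|%N%:R).
(** One power of [rho] more than in [geometric_remainder]: for the Poisson kernel it is a prefactor,
    for the logarithm the length of the interval in the mean value theorem. *)
Definition kernel_err rho N : R := 4 * rho ^+ N.+1 / (1 - rho) ^+ 2.

Lemma cosS2 N x :
  cos (N.+2%:R * x) = 2 * cos x * cos (N.+1%:R * x) - cos (N%:R * x).
Proof.
have -> : N.+2%:R * x = N.+1%:R * x + x by rewrite -natr1 mulrDl mul1r.
have -> : N%:R * x = N.+1%:R * x - x by rewrite -natr1 mulrDl mul1r addrK.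
by rewrite cosB cosD; ring.
Qed.

(* The real part of a finite geometric sum in [rho e^(ix)]: it yields explicit
   remainders for both the Poisson kernel and its primitive in [rho]. *)
Lemma qpol_geometric rho x N :
  qpol rho x * (\sum_(0 <= p < N) rho ^+ p * (2 * cos (p.+1%:R * x))) =
  2 * cos x - 2 * rho - 2 * rho ^+ N * cos (N.+1%:R * x) +
  2 * rho ^+ N.+1 * cos (N%:R * x).
Proof.
elim: N => [|N IH].
  by rewrite big_nil mul0r cos0 mul1r !expr0 expr1; ring.
rewrite big_nat_recr//= mulrDr IH cosS2 /qpol !exprS; ring.
Qed.

Lemma qpol_ge rho x : 0 <= rho -> (1 - rho) ^+ 2 <= qpol rho x.
Proof. by move=> r0; rewrite /qpol; have := cos_le1 x; nra. Qed.

Lemma qpol_gt0 rho x : 0 <= rho < 1 -> 0 < qpol rho x.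
Proof.
move=> /andP[r0 r1]; apply: lt_le_trans (qpol_ge x r0).
by rewrite exprn_gt0// subr_gt0.
Qed.

(** Up to a factor [- rho] this quotient is the remainder of the Poisson series; it is also the
    derivative in [rho] of the remainder of the logarithmic series. The denominator is at least (1 -
    rho)^2. *)
Lemma geometric_remainder rho x N : 0 <= rho < 1 ->
  `|(2 * rho ^+ N.+1 * cos (N%:R * x) - 2 * rho ^+ N * cos (N.+1%:R * x)) /
    qpol rho x| <= 4 * rho ^+ N / (1 - rho) ^+ 2.
Proof.
move=> r01; have q0 := qpol_gt0 x r01; case/andP: r01 => r0 r1.
rewrite normrM normfV [X in _ * X^-1]gtr0_norm// ler_pM//.
- by rewrite invr_ge0 ltW.
- have := cos_le1 (N.+1%:R * x); have := cos_geN1 (N.+1%:R * x).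
  have := cos_le1 (N%:R * x); have := cos_geN1 (N%:R * x).
  move: (cos (N%:R * x)) (cos (N.+1%:R * x)) => a b a1 a2 b1 b2.
  have e0 : 0 <= rho ^+ N by exact: exprn_ge0.
  have e1 : rho ^+ N.+1 <= rho ^+ N by rewrite exprS ler_piMl// ltW.
  have e2 : 0 <= rho ^+ N.+1 by exact: exprn_ge0.
  by rewrite ler_norml; apply/andP; split; nra.
- by rewrite lef_pV2 ?posrE// ?qpol_ge// exprn_gt0// subr_gt0.
Qed.

Lemma kernel_errE rho N :
  kernel_err rho N = rho * (4 * rho ^+ N / (1 - rho) ^+ 2).
Proof. by rewrite /kernel_err exprS mulrCA !mulrA. Qed.

Lemma kernel_err_cvg rho : 0 <= rho < 1 ->
  kernel_err rho N @[N --> \oo] --> (0 : R).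
Proof.
move=> /andP[r0 r1]; rewrite /kernel_err.
rewrite (_ : (fun N => _) =
    (fun N => (4 * rho / (1 - rho) ^+ 2) * rho ^+ N)); last first.
  by apply/funext => N; rewrite exprS; ring.
rewrite -[X in _ --> X](mulr0 (4 * rho / (1 - rho) ^+ 2)).
apply: cvgM; first exact: cvg_cst.
by apply: cvg_expr; rewrite ger0_norm.
Qed.

Lemma qpol_continuous rho : continuous (qpol rho).
Proof.
move=> x; apply: cvgD; last exact: cvg_cst.
apply: cvgB; first exact: cvg_cst.
by apply: cvgM; [exact: cvg_cst|exact: continuous_cos].
Qed.

Lemma measurable_qpol rho : measurable_fun setT (qpol rho).
Proof. by apply: continuous_measurable_fun; exact: qpol_continuous. Qed.

Lemma fourier_kernel_poisson rho : 0 <= rho < 1 ->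
  fourier_kernel (poisson rho) (poisson_weight rho) (kernel_err rho).
Proof.
move=> r01; split.
- apply: continuous_measurable_fun => x; apply: cvgM; first exact: cvg_cst.
  by apply: cvgV; [rewrite gt_eqF// qpol_gt0|exact: qpol_continuous].
- exact: kernel_err_cvg.
- move=> N x; rewrite trigpoly_cos; last by move=> n; rewrite /poisson_weight abszN.
  rewrite -rmorphB/= norm1_real /poisson_weight/= expr0.
  have q0 : qpol rho x != 0 by rewrite gt_eqF// qpol_gt0.
  have -> : poisson rho x -
      (1 + \sum_(0 <= p < N) rho ^+ p.+1 * (2 * cos (p.+1%:R * x))) =
    - rho * ((2 * rho ^+ N.+1 * cos (N%:R * x) -
      2 * rho ^+ N * cos (N.+1%:R * x)) / qpol rho x).
    under eq_bigr do rewrite exprS -mulrA.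
    rewrite -mulr_sumr.
    apply: (mulfI q0); rewrite mulrBr mulrDr /poisson [_ * (_ / _)]mulrC divfK//.
    rewrite [qpol _ _ * (rho * _)]mulrCA qpol_geometric [RHS]mulrCA.
    rewrite [qpol _ _ * (_ / _)]mulrC divfK//.
    by rewrite /qpol; ring.
  rewrite normrM normrN; case/andP: (r01) => r0 r1; rewrite (ger0_norm r0).
  rewrite kernel_errE ler_wpM2l//.
  exact: geometric_remainder.
Qed.

Lemma is_derive_power_sum (a : nat -> R) N rho :
  is_derive rho 1 (fun s => \sum_(0 <= p < N) s ^+ p.+1 / p.+1%:R * a p)
    (\sum_(0 <= p < N) rho ^+ p * a p).
Proof.
elim: N => [|N IH].
  rewrite big_nil; under eq_fun do rewrite big_nil; exact: is_derive_cst.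
rewrite big_nat_recr//=; under eq_fun do rewrite big_nat_recr//=.
apply: is_deriveD.
have dX : is_derive rho 1 (fun s : R => s ^+ N.+1) (N.+1%:R * rho ^+ N).
  rewrite (_ : (fun s : R => _) = (@id R) ^+ N.+1); last first.
    by apply/funext => s; rewrite exprfctE.
  by apply: is_derive_eq; rewrite /GRing.scale/= mulr1.
rewrite (_ : (fun s : R => _) = (a N / N.+1%:R) \*: (fun s : R => s ^+ N.+1)).
  apply: (@is_derive_eq _ _ _ _ _ _ _ _ (is_deriveZ _ dX)).
  by rewrite /GRing.scale/=; field; rewrite addrC natr1 pnatr_eq0.
by apply/funext => s /=; rewrite /GRing.scale/= [RHS]mulrC mulrA mulrAC.
Qed.

Lemma is_derive_log_qpol rho x : 0 <= rho < 1 ->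
  is_derive rho 1 (log_qpol ^~ x) ((2 * rho - 2 * cos x) / qpol rho x).
Proof.
move=> r01; have q0 := qpol_gt0 x r01.
have dq : is_derive rho 1 (qpol ^~ x) (2 * rho - 2 * cos x).
  apply: is_derive_eq; rewrite /GRing.scale/=; ring.
have := is_derive1_ln q0 => dl.
rewrite mulrC; exact: (@is_derive1_comp _ _ (qpol ^~ x) _ _ _ dl dq).
Qed.

(** The remainder [g] vanishes at radius 0 and its derivative is a geometric remainder, whose bound
    increases with the radius. The mean value theorem on [0, rho] concludes. *)
Lemma fourier_kernel_log rho : 0 <= rho < 1 ->
  fourier_kernel (log_qpol rho) (log_weight rho) (kernel_err rho).
Proof.
move=> r01; split.
- apply: continuous_measurable_fun => x; apply: continuous_comp.
    exact: qpol_continuous.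
  exact/continuous_ln/qpol_gt0.
- exact: kernel_err_cvg.
- move=> N x; rewrite trigpoly_cos; last by move=> n; rewrite /log_weight abszN.
  rewrite -rmorphB/= norm1_real {1}/log_weight/= invr0 mulr0 oppr0 add0r.
  pose a p := 2 * cos (p.+1%:R * x).
  pose g s := log_qpol s x + \sum_(0 <= p < N) s ^+ p.+1 / p.+1%:R * a p.
  pose g' s := (2 * s ^+ N.+1 * cos (N%:R * x) -
      2 * s ^+ N * cos (N.+1%:R * x)) / qpol s x.
  have dg (s : R) : 0 <= s < 1 -> is_derive s 1 g (g' s).
    move=> s01; have d1 := is_derive_log_qpol x s01.
    have d2 := is_derive_power_sum a N s.
    apply: (@is_derive_eq _ _ _ _ _ _ _ _ (is_deriveD d1 d2)).
    have q0 : qpol s x != 0 by rewrite gt_eqF// qpol_gt0.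
    apply: (mulfI q0); rewrite mulrDr qpol_geometric /g'.
    by rewrite ![qpol _ _ * (_ / _)]mulrC !divfK//; ring.
  have -> : log_qpol rho x -
      \sum_(0 <= p < N) log_weight rho p.+1 * (2 * cos (p.+1%:R * x)) = g rho.
    rewrite /g -sumrN; congr (_ + _); apply: eq_bigr => p _.
    by rewrite /log_weight mulNr opprK.
  have g0 : g 0 = 0.
    rewrite /g big1 => [|p _]; last by rewrite exprS !mul0r.
    by rewrite /log_qpol /qpol mulr0 mul0r subr0 expr0n /= !addr0 ln1.
  case/andP: (r01) => r0 r1.
  have [||c] := @MVT_segment _ g g' 0 rho r0.
  + move=> s; rewrite in_itv/= => /andP[s0 sr]; apply: dg.
    by rewrite ltW//= (lt_trans sr).
  + apply: derivable_within_continuous => s; rewrite in_itv/= => /andP[s0 sr].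
    by have /dg[] : 0 <= s < 1 by rewrite s0/= (le_lt_trans sr).
  rewrite in_itv/= => /andP[c0 cr]; rewrite g0 !subr0 => ->.
  have c1 : c < 1 by rewrite (le_lt_trans cr).
  rewrite normrM [X in _ * X](ger0_norm r0) mulrC kernel_errE ler_wpM2l//.
  rewrite (le_trans (geometric_remainder x N _)) ?c0//.
  rewrite ler_pM//.
  + by rewrite mulr_ge0// exprn_ge0.
  + by rewrite invr_ge0 sqr_ge0.
  + by rewrite ler_wpM2l// lerXn2r// nnegrE.
  + rewrite lef_pV2 ?posrE ?exprn_gt0 ?subr_gt0//.
    by rewrite lerXn2r ?nnegrE ?subr_ge0 ?(ltW c1) ?(ltW r1)// lerB.
Qed.

End PoissonKernel.

(** * The logarithmic kernel of a single circle *)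

Section SingularLogKernel.
Context {R : realType}.
Implicit Types (x t : R) (n : int) (k : nat).

Local Open Scope classical_set_scope.
Local Open Scope ring_scope.
Local Notation mu := (@lebesgue_measure R).
Local Notation A := (@angles R).

Lemma ae_neq (x0 : R) (P : R -> Prop) : (forall t, t != x0 -> P t) ->
  {ae mu, forall t, P t}.
Proof.
move=> HP; exists [set x0]; split.
- exact: measurable_set1.
- exact: lebesgue_measure_set1.
- by move=> t /= nP; apply/eqP/negPn/negP => /HP.
Qed.

Lemma Rintegral_dominated (f_ : nat -> R -> R) (f g : R -> R) (x0 : R) :
  (forall k, measurable_fun A (f_ k)) -> measurable_fun A f ->
  (forall t, A t -> t != x0 -> f_ k t @[k --> \oo] --> f t) ->
  rintegrable g -> (forall k t, A t -> t != x0 -> `|f_ k t| <= g t) ->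
  \int[mu]_(t in A) f_ k t @[k --> \oo] --> \int[mu]_(t in A) f t.
Proof.
move=> mf_ mf ff ig fg.
have [||||fi _ H] := @dominated_convergence _ _ _ mu A (measurable_angles (R:=R))
  (fun k t => (f_ k t)%:E) (EFin \o f) (EFin \o g) _ _ _ ig.
- by move=> k; apply/measurable_EFinP; exact: mf_.
- by apply/measurable_EFinP; exact: mf.
- apply: (ae_neq (x0 := x0)) => t tx At.
  by apply: cvg_EFin; [exact: nearW|exact: ff].
- by apply: (ae_neq (x0 := x0)) => t tx k At; rewrite /= lee_fin fg.
apply: fine_cvg; rewrite fineK; first exact: H.
exact: (integrable_fin_num (measurable_angles (R:=R)) fi).
Qed.

Lemma qpol1E x : qpol 1 x = 2 * (1 - cos x).
Proof. by rewrite /qpol; ring. Qed.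

Lemma qpol1_ge0 x : 0 <= qpol 1 x.
Proof. by rewrite qpol1E; have := cos_le1 x; lra. Qed.

Lemma qpol_le4 (rho x : R) : 0 <= rho <= 1 -> qpol rho x <= 4.
Proof. by move=> /andP[r0 r1]; rewrite /qpol; have := cos_geN1 x; nra. Qed.

(** Half-angle formula: [qpol 1 u] is 4 sin^2 (u / 2), and half the difference of two angles of
    ]-pi, pi] lies strictly between -pi and pi, where the sine vanishes only at 0. *)
Lemma qpol1_gt0 x t : A x -> A t -> t != x -> 0 < qpol 1 (x - t).
Proof.
rewrite /angles/= !in_itv/= => /andP[x1 x2] /andP[t1 t2] tx.
rewrite lt_neqAle qpol1_ge0 andbT eq_sym qpol1E; apply/negP => /eqP H.
have : cos ((x - t) / 2 *+ 2) = 1.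
  rewrite -mulr_natr divfK//; lra.
rewrite cos_mulr2n => H2.
have s0 : sin ((x - t) / 2) ^+ 2 = 0 by rewrite sin2cos2; lra.
have {s0 H H2}s0 : sin ((x - t) / 2) = 0 by apply/eqP; rewrite -sqrf_eq0 s0.
have := pi_gt0 R => p0.
have [xt|xt|xt] := ltgtP x t.
- have : 0 < sin (- ((x - t) / 2)) by apply: sin_gt0_pi; lra.
  by rewrite sinN s0 oppr0 ltxx.
- have : 0 < sin ((x - t) / 2) by apply: sin_gt0_pi; lra.
  by rewrite s0 ltxx.
- by rewrite xt eqxx in tx.
Qed.

(* Radii stay above 1/2 so that [log_dominated] is uniform in [k]. *)
Let rad k : R := 1 - 2^-1 * k.+1%:R^-1.

Let rad01 k : 0 <= rad k < 1.
Proof.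
have : 0 < k.+1%:R^-1 :> R by rewrite invr_gt0.
have : k.+1%:R^-1 <= 1 :> R by rewrite invf_le1// ler1n.
by rewrite /rad; move: (k.+1%:R^-1) => u; lra.
Qed.

Let rad_half k : 2^-1 <= rad k.
Proof.
have : k.+1%:R^-1 <= 1 :> R by rewrite invf_le1// ler1n.
by rewrite /rad; move: (k.+1%:R^-1) => u; lra.
Qed.

Let rad_cvg : rad k @[k --> \oo] --> (1 : R).
Proof.
rewrite -[X in _ --> X]subr0 -[X in _ --> _ - X](mulr0 (2^-1 : R)).
apply: cvgB; first exact: cvg_cst.
by apply: cvgM; [exact: cvg_cst|exact: cvg_harmonic].
Qed.

Let log_cvg x : 0 < qpol 1 x -> log_qpol (rad k) x @[k --> \oo] --> log_qpol 1 x.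
Proof.
move=> q0; have := continuous_ln q0.
apply: (@cvg_comp _ _ _ (fun k => qpol (rad k) x) (@ln R)).
rewrite /qpol; apply: cvgD; last by rewrite expr2; apply: cvgM rad_cvg rad_cvg.
apply: cvgB; first exact: cvg_cst.
apply: cvgM; last exact: cvg_cst.
by apply: cvgM; [exact: cvg_cst|exact: rad_cvg].
Qed.

Let log_le4 k x : log_qpol (rad k) x <= ln 4.
Proof.
have /andP[r0 r1] := rad01 k.
by rewrite ler_ln ?posrE ?qpol_le4 ?qpol_gt0 ?r0// ltW.
Qed.

Lemma measurable_log_qpol (rho : R) : measurable_fun setT (log_qpol rho).
Proof. exact: (measurableT_comp (@measurable_ln R) (measurable_qpol rho)). Qed.

Let measurable_logB (rho x : R) : measurable_fun A (fun t => log_qpol rho (x - t)).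
Proof.
apply: (measurableT_comp (measurable_log_qpol rho)).
by under eq_fun do rewrite addrC -mulN1r; exact: measurable_affine.
Qed.

Let log_integrable (rho x : R) : 0 <= rho < 1 ->
  rintegrable (fun t => log_qpol rho (x - t)).
Proof.
move=> r01; have [M kM] := fourier_kernel_bounded (fourier_kernel_log r01).
by apply: (@rintegrable_bounded _ M).
Qed.

(* Mean value property of the harmonic function [ln |1 - z|]. *)
Let log_mean0 (rho x : R) : 0 <= rho < 1 ->
  \int[mu]_(t in A) log_qpol rho (x - t) = 0.
Proof.
move=> r01; have := kernel_expi 0 x (fourier_kernel_log r01).
rewrite /log_weight/= invr0 mulr0 oppr0 mulr0 mul0r => /(congr1 (@complex.Re R)) /= H.
rewrite -[RHS]H; apply: eq_Rintegral => t _.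
by rewrite !mul0r subr0 cos0 mulr1.
Qed.

(* Since [log_qpol (rad k)] has mean 0 for every [k], Fatou's lemma bounds the
   integral of [ln 4 - log_qpol 1]. *)
Lemma log_qpol1_integrable x : A x ->
  rintegrable (fun t => log_qpol 1 (x - t)).
Proof.
move=> Ax; pose g k t := ln 4 - log_qpol (rad k) (x - t).
have mg k : measurable_fun A (g k).
  by apply: measurable_funB; [exact: measurable_cst|exact: measurable_logB].
have ig k : rintegrable (g k).
  apply: rintegrableD; first exact: rintegrable_cst.
  apply: (eq_rintegrable (f := fun t => - 1 * log_qpol (rad k) (x - t))).
    by move=> t _; rewrite mulN1r.
  by apply: rintegrableZ; exact: log_integrable.
have intg k : (\int[mu]_(t in A) (g k t)%:E)%E = (ln 4 * (2 * pi))%:E.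
  rewrite -[LHS]fineK; last exact: (integrable_fin_num (measurable_angles (R:=R)) (ig k)).
  congr (_%:E); rewrite -[LHS]/(\int[mu]_(t in A) g k t) /g RintegralB.
  - by rewrite log_mean0// subr0 Rintegral_angles_cst.
  - exact: measurable_angles.
  - exact: rintegrable_cst.
  - exact: log_integrable.
have := @fatou _ _ _ mu A (measurable_angles (R:=R)) (fun k t => (g k t)%:E).
under [X in _ -> _ -> (_ <= limn_einf X)%E]eq_fun do rewrite intg.
rewrite [X in _ -> _ -> (_ <= X)%E]is_cvg_limn_einfE; last exact: is_cvg_cst.
rewrite lim_cst// => F.
have {}F : (\int[mu]_(t in A) limn_einf (fun k => (g k t)%:E) <= (ln 4 * (2 * pi))%:E)%E.
  apply: F; first by move=> k; apply/measurable_EFinP; exact: mg.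
  by move=> k t _; rewrite lee_fin subr_ge0.
pose g1 t := ln 4 - log_qpol 1 (x - t).
have mg1 : measurable_fun A g1.
  by apply: measurable_funB; [exact: measurable_cst|exact: measurable_logB].
have g1_ge0 t : 0 <= g1 t.
  rewrite subr_ge0; have := qpol1_ge0 (x - t); rewrite le_eqVlt => /predU1P[q0|q0].
    by rewrite /log_qpol -q0 ln0// ln_ge0// ler1n.
  by rewrite ler_ln ?posrE ?qpol_le4 ?ler01 ?lexx.
have g1_le t : A t -> ((g1 t)%:E <= limn_einf (fun k => (g k t)%:E))%E.
  move=> At; have [->|tx] := eqVneq t x.
    (* On the diagonal [log_qpol 1 0] is [ln 0], that is 0 by default, while the approximants are ln
       ((1 - rad)^2) <= 0; so the inequality survives there too. *)
    rewrite limn_einf_lim; apply: lime_ge; first exact: is_cvg_einfs.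
    apply: nearW => k; apply: le_ereal_inf_tmp => _ [m /= km <-].
    rewrite lee_fin lerD2l lerN2 subrr /log_qpol /qpol cos0.
    rewrite [X in _ <= ln X](_ : _ = 0); last by ring.
    have /andP[r0 r1] := rad01 m.
    by rewrite [leRHS]ln0//; apply: ln_le0; nra.
  rewrite is_cvg_limn_einfE.
    rewrite le_eqVlt; apply/orP; left; apply/eqP/esym/cvg_lim => //.
    apply: cvg_EFin; first exact: nearW.
    apply: cvgB; first exact: cvg_cst.
    exact/log_cvg/qpol1_gt0.
  apply/cvg_ex; exists (g1 t)%:E; apply: cvg_EFin; first exact: nearW.
  apply: cvgB; first exact: cvg_cst.
  exact/log_cvg/qpol1_gt0.
have mlim : @measurable_fun _ _ (measurableTypeR R) _ A
    (fun t => limn_einf (fun k => (g k t)%:E)).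
  have m1 k : @measurable_fun _ _ (measurableTypeR R) _ A
      (fun t => einfs (fun k => (g k t)%:E) k).
    by apply: measurable_fun_einfs => p; apply/measurable_EFinP; exact: mg.
  apply: (emeasurable_fun_cvg _ _ m1) => t _.
  by rewrite limn_einf_lim; exact: is_cvg_einfs.
have ig1 : rintegrable g1.
  apply/integrableP; split; first exact/measurable_EFinP.
  apply: le_lt_trans (ltry (ln 4 * (2 * pi))); apply: le_trans F.
  apply: ge0_le_integral => //.
  - exact: measurable_angles.
  - by apply/measurable_EFinP; exact: measurableT_comp.
  - by move=> t At; rewrite [X in (X <= _)%E](_ : _ = (g1 t)%:E) ?g1_le//= ger0_norm.
apply: (eq_rintegrable (f := fun t => ln 4 + - 1 * g1 t)).
  by move=> t _; rewrite /g1; ring.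
by apply: rintegrableD; [exact: rintegrable_cst|exact: rintegrableZ].
Qed.

(** For a radius s in [1/2, 1], [qpol s x] = (1 - s)^2 + s * [qpol 1 x] is at least half of
    [qpol 1 x], which costs only [ln 2] from below; from above it is at most 4. *)
Let log_dominated k x : 0 < qpol 1 x ->
  `|log_qpol (rad k) x| <= ln 4 + `|log_qpol 1 x|.
Proof.
move=> q0; have /andP[r0 r1] := rad01 k; have r2 := rad_half k.
have l4 : ln 4 = ln 2 + ln 2 :> R.
  by rewrite -lnM ?posrE// -natrM.
have l2 : 0 <= ln 2 :> R by rewrite ln_ge0// ler1n.
have lo : log_qpol 1 x - ln 2 <= log_qpol (rad k) x.
  have qk : 0 < qpol (rad k) x by rewrite qpol_gt0 ?r0.
  rewrite /log_qpol -ln_div ?posrE// ler_ln ?posrE ?divr_gt0//.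
  rewrite ler_pdivrMr// qpol1E /qpol; have := cos_le1 x; nra.
rewrite ler_norml; apply/andP; split; last first.
  by rewrite (le_trans (log_le4 k x))// lerDl.
have := ler_norm (- log_qpol 1 x); rewrite normrN; lra.
Qed.

Lemma log_qpol1_expi n x : A x ->
  cintegral (fun t => (log_qpol 1 (x - t))%:C * expi (n%:~R * t)) =
  (2 * pi * log_weight 1 n)%:C * expi (n%:~R * x).
Proof.
move=> Ax.
have wcvg : 2 * pi * log_weight (rad k) n @[k --> \oo] --> 2 * pi * log_weight 1 n.
  apply: cvgM; first exact: cvg_cst.
  apply: cvgN; apply: cvgM; last exact: cvg_cst.
  exact: (@cvg_comp _ _ _ rad (fun r : R => r ^+ `|n|%N) _ _ _ rad_cvg (@exprn_continuous R _ _)).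
(* The real and imaginary parts of the claim are two instances: [c] is the cosine or sine of [n t],
   and [L] that of [n x]. *)
have key (c : R -> R) (L : R) : measurable_fun A c -> (forall t, `|c t| <= 1) ->
    (forall k, \int[mu]_(t in A) (log_qpol (rad k) (x - t) * c t) =
               2 * pi * log_weight (rad k) n * L) ->
    \int[mu]_(t in A) (log_qpol 1 (x - t) * c t) = 2 * pi * log_weight 1 n * L.
  move=> mc c1 H.
  have lim1 : 2 * pi * log_weight (rad k) n * L @[k --> \oo] -->
      2 * pi * log_weight 1 n * L by apply: cvgM; [exact: wcvg|exact: cvg_cst].
  rewrite -(cvg_lim _ lim1)//; apply/esym/cvg_lim => //.
  under eq_fun do rewrite -H.
  apply: (@Rintegral_dominated _ _ (fun t => ln 4 + `|log_qpol 1 (x - t)|) x).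
  - by move=> k; apply: measurable_funM => //; exact: measurable_logB.
  - by apply: measurable_funM => //; exact: measurable_logB.
  - move=> t At tx; apply: cvgM; last exact: cvg_cst.
    exact/log_cvg/qpol1_gt0.
  - apply: rintegrableD; first exact: rintegrable_cst.
    by apply: rintegrable_norm; exact: log_qpol1_integrable.
  - move=> k t At tx; rewrite normrM -[leRHS]mulr1 ler_pM//.
    exact/log_dominated/qpol1_gt0.
have K k := kernel_expi n x (fourier_kernel_log (rad01 k)).
apply: complexP; rewrite /= ?mul0r ?subr0 ?addr0.
- under eq_Rintegral do rewrite mul0r subr0.
  apply: (key (fun t => cos (n%:~R * t)) (cos (n%:~R * x))).
  + by have [] := cmeasurable_expiZ (R:=R) n%:~R.
  + by move=> t; rewrite ler_norml cos_geN1 cos_le1.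
  + move=> k; have /(congr1 (@complex.Re R)) := K k; rewrite /= mul0r subr0 => <-.
    by apply: eq_Rintegral => t _; rewrite mul0r subr0.
- under eq_Rintegral do rewrite mul0r addr0.
  apply: (key (fun t => sin (n%:~R * t)) (sin (n%:~R * x))).
  + by have [] := cmeasurable_expiZ (R:=R) n%:~R.
  + by move=> t; rewrite ler_norml sin_geN1 sin_le1.
  + move=> k; have /(congr1 (@complex.Im R)) := K k; rewrite /= mul0r addr0 => <-.
    by apply: eq_Rintegral => t _; rewrite mul0r addr0.
Qed.

End SingularLogKernel.

(** * Distances and angles in bipolar coordinates *)

Section BipolarGeometry.
Context {R : realType}.
Variables r eps : R.
Hypotheses (hr : 0 < r) (heps : 0 < eps).
Implicit Types (x t : R) (i j : 'I_2).

Local Open Scope classical_set_scope.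
Local Open Scope ring_scope.
Local Notation A := (@angles R).
Local Notation al := (alpha r eps).
Local Notation C := (cosh (xi0 r eps)).
Local Notation S := (sinh (xi0 r eps)).
Local Notation h0 := (h r eps (xi0 r eps)).

Definition rho : R := expR (- (2 * xi0 r eps)).

Lemma alpha_gt0 : 0 < al.
Proof. by rewrite sqrtr_gt0 mulr_gt0// addr_gt0// divr_gt0. Qed.

Lemma sinh_xi0 : S = al / r.
Proof. exact: asinhK. Qed.

Lemma sinh_xi0_gt0 : 0 < S.
Proof. by rewrite sinh_xi0 divr_gt0// alpha_gt0. Qed.

Lemma alphaE : al = r * S.
Proof. by rewrite sinh_xi0 mulrC divfK// gt_eqF. Qed.

(** The choice of [alpha] makes alpha^2 + r^2 = (r + eps / 2)^2; divide by r^2 and take square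
    roots. *)
Lemma cosh_xi0 : r * C = r + eps / 2.
Proof.
move: hr heps => r0 e0; have C0 : 0 < C by exact: cosh_gt0.
have a2 : al ^+ 2 = eps * (r + eps / 4).
  by rewrite sqr_sqrtr// mulr_ge0//; lra.
have S2 : (r * S) ^+ 2 = eps * (r + eps / 4) by rewrite -alphaE.
have C2 : C ^+ 2 = 1 + S ^+ 2 by exact: cosh2E.
apply/eqP; rewrite -(@eqrXn2 _ 2)//; last 2 first.
- by rewrite mulr_ge0// ltW.
- by lra.
by apply/eqP; rewrite exprMn C2 mulrDr -exprMn S2; field.
Qed.

Lemma cosh_xi0_gt1 : 1 < C.
Proof.
rewrite -(ltr_pM2l hr) mulr1 cosh_xi0; move: heps; lra.
Qed.

Lemma cosh_xi0_gt_cos t : 0 < C - cos t.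
Proof. by have := cosh_xi0_gt1; have := cos_le1 t; lra. Qed.

Lemma xi0_gt0 : 0 < xi0 r eps.
Proof.
have a0 : 0 < al / r by rewrite divr_gt0// alpha_gt0.
rewrite /xi0 /asinh ln_gt0//; set s := Num.sqrt _.
have s2 : s ^+ 2 = (al / r) ^+ 2 + 1 by rewrite sqr_sqrtr// addr_ge0// sqr_ge0.
have s0 : 0 <= s by exact: sqrtr_ge0.
move: (al / r) s a0 s0 s2 => a s a0 s0 s2; nra.
Qed.

Lemma rho_gt0 : 0 < rho. Proof. exact: expR_gt0. Qed.

Lemma rho_lt1 : rho < 1.
Proof. by rewrite expR_lt1 oppr_lt0 mulr_gt0// xi0_gt0. Qed.

Lemma rho01 : 0 <= rho < 1.
Proof. by rewrite rho_lt1 ltW// rho_gt0. Qed.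

Lemma rho_expE (n : int) : expR (- (2 * `|n|%:~R * xi0 r eps)) = rho ^+ `|n|%N.
Proof.
rewrite /rho -expRM_natl; congr expR.
by rewrite -natr_absz; ring.
Qed.

Lemma hE t : h0 t = (C - cos t) / al. Proof. by []. Qed.

Lemma h_gt0 t : 0 < h0 t.
Proof. by rewrite hE divr_gt0 ?cosh_xi0_gt_cos ?alpha_gt0. Qed.

Lemma hN t : h r eps (- xi0 r eps) t = h0 t.
Proof. by rewrite /h coshN. Qed.

Definition h_min : R := (C - 1) / al.
Definition h_max : R := (C + 1) / al.

Lemma h_min_gt0 : 0 < h_min.
Proof. by rewrite divr_gt0 ?alpha_gt0// subr_gt0 cosh_xi0_gt1. Qed.

Lemma h_max_gt0 : 0 < h_max.
Proof. by rewrite divr_gt0 ?alpha_gt0// addr_gt0// cosh_gt0. Qed.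

Lemma h_ge t : h_min <= h0 t.
Proof.
rewrite hE ler_pM2r ?invr_gt0 ?alpha_gt0//; have := cos_le1 t; lra.
Qed.

Lemma h_le t : h0 t <= h_max.
Proof.
rewrite hE ler_pM2r ?invr_gt0 ?alpha_gt0//; have := cos_geN1 t; lra.
Qed.

Lemma measurable_h : measurable_fun setT h0.
Proof.
apply: continuous_measurable_fun => x; apply: cvgM; last exact: cvg_cst.
by apply: cvgB; [exact: cvg_cst|exact: continuous_cos].
Qed.

Let sg i : R := (-1) ^+ i.+1.

Lemma bdryE i t : bdry r eps i t =
  (al * (sg i * S / (C - cos t)), al * (sin t / (C - cos t))).
Proof.
rewrite /bdry /bipolar /sg -signr_odd.
by case: odd; rewrite ?mulN1r ?coshN ?sinhN ?mul1r.
Qed.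

(* Squared distances between boundary points are governed by [qpol]: at radius 1
   for points of the same circle, at radius [rho] for points of different ones. *)
Definition radius i j : R := if i == j then 1 else rho.

Lemma radius_gt0 i j : 0 < radius i j.
Proof. by rewrite /radius; case: ifP => // _; exact: rho_gt0. Qed.

Lemma neq_sg i j : i != j -> sg j = - sg i.
Proof.
rewrite /sg; case: i j => [[|[|//]] ?] [[|[|//]] ?] //= _;
by rewrite expr1 expr2 ?mulN1r ?opprK.
Qed.

Lemma sg2 i : sg i ^+ 2 = 1.
Proof. by rewrite sqrr_sign. Qed.

Let E := expR (xi0 r eps).
Let E0 : E != 0. Proof. by rewrite gt_eqF// expR_gt0. Qed.
Let rhoE : rho = E ^- 2.
Proof. by rewrite /rho expRN mulr_natl mulr2n expRD expr2. Qed.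

(** Here 2 C^2 - 1 = cosh (2 xi0) = (1 + rho^2) / (2 rho). *)
Lemma qpol_rhoE x : qpol rho x = 2 * rho * (2 * C ^+ 2 - 1 - cos x).
Proof. by rewrite rhoE /qpol /cosh expRN -/E; field. Qed.

Lemma one_sub_rho2 : 1 - rho ^+ 2 = 4 * rho * (S * C).
Proof. by rewrite rhoE /cosh /sinh expRN -/E; field. Qed.

Lemma poisson_rhoE x : poisson rho x = 2 * (S * C) / (2 * C ^+ 2 - 1 - cos x).
Proof.
have p0 : 0 < 2 * C ^+ 2 - 1 - cos x.
  by have := cos_le1 x; have := cosh_xi0_gt1; nra.
have := rho_gt0 => r0.
rewrite /poisson one_sub_rho2 qpol_rhoE; field.
by rewrite !gt_eqF.
Qed.

Lemma dist2E i j x t :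
  dot2 (bdry r eps i x - bdry r eps j t) (bdry r eps i x - bdry r eps j t) =
  qpol (radius i j) (x - t) / (radius i j * h0 x * h0 t).
Proof.
rewrite !bdryE /dot2/= !hE.
have a0 : al != 0 by rewrite gt_eqF// alpha_gt0.
have D1 : C - cos x != 0 by rewrite gt_eqF// cosh_xi0_gt_cos.
have D2 : C - cos t != 0 by rewrite gt_eqF// cosh_xi0_gt_cos.
have CS : S ^+ 2 = C ^+ 2 - 1 by rewrite [C ^+ 2]cosh2E addrAC subrr add0r.
have s1 : sin x ^+ 2 = 1 - cos x ^+ 2 by rewrite sin2cos2.
have s2 : sin t ^+ 2 = 1 - cos t ^+ 2 by rewrite sin2cos2.
have g2 := sg2 i.
rewrite /radius; have [<-|ij] := eqVneq i j.
- rewrite qpol1E cosB.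
  (* [field] ignores the relations between sine and cosine, [S] and [C], and the sign [sg]. This
     form exposes their squares, so that the relations can be rewritten before the final [field]. *)
  transitivity (al ^+ 2 * (sg i ^+ 2 * S ^+ 2 * (cos x - cos t) ^+ 2 +
     sin x ^+ 2 * (C - cos t) ^+ 2 + sin t ^+ 2 * (C - cos x) ^+ 2
     - 2 * sin x * sin t * (C - cos x) * (C - cos t)) /
     ((C - cos x) ^+ 2 * (C - cos t) ^+ 2)); first by field; rewrite ?D1 ?D2.
  by rewrite g2 CS s1 s2; field; rewrite ?D1 ?a0 ?D2.
- rewrite (neq_sg ij) qpol_rhoE cosB.
  transitivity (al ^+ 2 * (sg i ^+ 2 * S ^+ 2 * (2 * C - cos x - cos t) ^+ 2 +
     sin x ^+ 2 * (C - cos t) ^+ 2 + sin t ^+ 2 * (C - cos x) ^+ 2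
     - 2 * sin x * sin t * (C - cos x) * (C - cos t)) /
     ((C - cos x) ^+ 2 * (C - cos t) ^+ 2)); first by field; rewrite ?D1 ?D2.
  have r0 : rho != 0 by rewrite gt_eqF// rho_gt0.
  by rewrite g2 CS s1 s2; field; rewrite ?D1 ?a0 ?r0 ?D2.
Qed.

Lemma enorm2 (u : R * R) : enorm u ^+ 2 = dot2 u u.
Proof. by rewrite /enorm sqr_sqrtr// addr_ge0// -expr2 sqr_ge0. Qed.

(** Half the logarithm of [dist2E]. Apart from [log_qpol], only [ln (h0 t)] depends on the source
    angle; the other terms integrate to 0 against mean zero, and this one gives a constant in
    [x]. *)
Lemma ln_dist i j x t : 0 < qpol (radius i j) (x - t) ->
  ln (enorm (bdry r eps i x - bdry r eps j t)) =
  2^-1 * log_qpol (radius i j) (x - t) +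
  2^-1 * (- ln (radius i j) - ln (h0 x) - ln (h0 t)).
Proof.
move=> q0; have R0 := radius_gt0 i j; have hx := h_gt0 x; have ht := h_gt0 t.
set e := enorm _; have : e ^+ 2 = _ := enorm2 _; rewrite dist2E => e2.
have P1 : 0 < radius i j * h0 x by exact: mulr_gt0.
have P2 : 0 < radius i j * h0 x * h0 t by exact: mulr_gt0.
have e0 : 0 < e.
  rewrite lt_neqAle sqrtr_ge0 andbT eq_sym -sqrf_eq0 e2 gt_eqF//.
  exact: divr_gt0.
have : ln (e ^+ 2) = 2 * ln e by rewrite lnXn// mulr_natl.
rewrite e2 ln_div ?posrE// [ln (_ * h0 t)]lnM ?posrE// [ln (_ * h0 x)]lnM ?posrE//.
rewrite /log_qpol.
lra.
Qed.

Lemma normal_unit i x : A x ->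
  dot2 (normal r eps i (bdry r eps i x)) (normal r eps i (bdry r eps i x)) = 1.
Proof.
move=> Ax; have : circle r eps i (bdry r eps i x).
  by rewrite -bdry_circle//; exists x.
rewrite /circle/= => H; have r0 : r != 0 by rewrite gt_eqF.
have := enorm2 (bdry r eps i x - Defs.center r eps i); rewrite H /normal.
case: (_ - _) => a b; rewrite /dot2/= /GRing.scale/= => H2.
by apply: (mulfI (expf_neq0 2 r0)); rewrite mulr1 [RHS]H2; field.
Qed.

(** For points x, y of a circle with center c, expanding |y - c|^2 = |x - c|^2 gives |x - y|^2 = 2
    <x - y, x - c>. *)
Lemma np_kernel_same i x t : A x -> A t -> t != x ->
  dot2 (bdry r eps i x - bdry r eps i t) (normal r eps i (bdry r eps i x)) /
  enorm (bdry r eps i x - bdry r eps i t) ^+ 2 = (2 * r)^-1.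
Proof.
move=> Ax At tx; have r0 : r != 0 by rewrite gt_eqF.
have : circle r eps i (bdry r eps i x) by rewrite -bdry_circle//; exists x.
have : circle r eps i (bdry r eps i t) by rewrite -bdry_circle//; exists t.
rewrite /circle/= => ct cx.
have := enorm2 (bdry r eps i x - Defs.center r eps i); rewrite cx.
have := enorm2 (bdry r eps i t - Defs.center r eps i); rewrite ct.
have q0 : dot2 (bdry r eps i x - bdry r eps i t)
    (bdry r eps i x - bdry r eps i t) != 0.
  rewrite dist2E gt_eqF// divr_gt0//; first by rewrite /radius eqxx qpol1_gt0.
  exact: (mulr_gt0 (mulr_gt0 (radius_gt0 i i) (h_gt0 x)) (h_gt0 t)).
rewrite enorm2 /normal; move: q0.
case: (bdry r eps i x) => a b; case: (bdry r eps i t) => c d.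
case: (Defs.center r eps i) => p q; rewrite /dot2/= /GRing.scale/= => q0 H1 H2.
apply: (mulIf q0); rewrite divfK//.
have -> : (a - c) * (a - c) + (b - d) * (b - d) =
   2 * ((a - c) * (a - p) + (b - d) * (b - q)).
  by move: H1; rewrite H2; lra.
by field.
Qed.

(** The quotient is the normal derivative at the point of angle [x] of the logarithm of the
    distance. Its part independent of [t] is 1 / (2 r), as on a single circle, and disappears on
    mean zero densities; the rest is a Poisson kernel. *)
Lemma np_kernel_diff i j x t : i != j ->
  dot2 (bdry r eps i x - bdry r eps j t) (normal r eps i (bdry r eps i x)) /
  dot2 (bdry r eps i x - bdry r eps j t) (bdry r eps i x - bdry r eps j t) =
  S / (2 * al) - h0 x / 2 * poisson rho (x - t).
Proof.
move=> ij; rewrite dist2E /radius (negbTE ij) poisson_rhoE qpol_rhoE.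
rewrite /normal !bdryE (neq_sg ij) /dot2 /Defs.center/= /GRing.scale/= -cosh_xi0 -/(sg i).
rewrite !hE cosB alphaE.
have r0 : r != 0 by rewrite gt_eqF.
have S0 : S != 0 by rewrite gt_eqF// sinh_xi0_gt0.
have D1 : C - cos x != 0 by rewrite gt_eqF// cosh_xi0_gt_cos.
have D2 : C - cos t != 0 by rewrite gt_eqF// cosh_xi0_gt_cos.
have rho0 : rho != 0 by rewrite gt_eqF// rho_gt0.
have p0 : 2 * C ^+ 2 - 1 - (cos x * cos t + sin x * sin t) != 0.
  rewrite -cosB gt_eqF//.
  by have := cos_le1 (x - t); have := cosh_xi0_gt1; nra.
have CS : S ^+ 2 = C ^+ 2 - 1 by rewrite [C ^+ 2]cosh2E addrAC subrr add0r.
have s1 : sin x ^+ 2 = 1 - cos x ^+ 2 by rewrite sin2cos2.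
have g2 := sg2 i.
have -> : (r * S * (sg i * S / (C - cos x)) - r * S * (- sg i * S / (C - cos t))) *
    (r^-1 * (r * S * (sg i * S / (C - cos x)) - sg i * (r * C))) +
    (r * S * (sin x / (C - cos x)) - r * S * (sin t / (C - cos t))) *
    (r^-1 * (r * S * (sin x / (C - cos x)) - 0)) =
  r * S ^+ 2 * (sg i ^+ 2 * (2 * C - cos x - cos t) * (S ^+ 2 - C * (C - cos x)) +
    (sin x ^+ 2 * (C - cos t) - sin x * sin t * (C - cos x))) /
    ((C - cos x) ^+ 2 * (C - cos t)).
  by field; rewrite ?D1 ?D2 ?r0 ?D2.
rewrite g2 s1 [in X in _ * (X - C * _)]CS.
by field; rewrite ?D1 ?D2 ?r0 ?S0 ?p0 ?rho0 ?D2.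
Qed.

End BipolarGeometry.

(** * Differentiation of the potentials *)

Section PointModification.
Context {R : realType}.
Implicit Types (f g : R -> R) (x : R).

Local Open Scope classical_set_scope.
Local Open Scope ring_scope.
Local Notation mu := (@lebesgue_measure R).
Local Notation A := (@angles R).

Lemma measurable_fun_off_point f g x : measurable_fun A g ->
  (forall t, A t -> t != x -> f t = g t) -> measurable_fun A f.
Proof.
move=> mg fg; rewrite -(setDUK (A := A `&` [set x]) (B := A)); last exact: subIsetl.
have mAx : measurable (A `&` [set x]).
  by apply: measurableI; [exact: measurable_angles|exact: measurable_set1].
apply/measurable_funU; [exact: mAx| |split].
- by apply: measurableD; [exact: measurable_angles|exact: mAx].
- apply: (@measurable_funS _ _ _ _ [set x]); [exact: measurable_set1|exact: subIsetr|].
  exact: measurable_fun_set1.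
- apply: (eq_measurable_fun g).
    move=> t /set_mem [At nx]; rewrite fg//; apply/eqP => tx.
    by apply: nx; split.
  apply: (@measurable_funS _ _ _ _ A) => //; exact: measurable_angles.
Qed.

Lemma rintegrable_off_point f g x : rintegrable g ->
  (forall t, A t -> t != x -> f t = g t) -> rintegrable f.
Proof.
move=> ig fg; have mg := rintegrable_measurable ig.
have mf := measurable_fun_off_point mg fg.
apply: (@rintegrable_le _ _ (fun t => `|g t| + `|f x - g x|)) => //.
- move=> t At; have [->|tx] := eqVneq t x.
    by rewrite -{1}(subrK (g x) (f x)) addrC (le_trans (ler_normD _ _)).
  by rewrite fg// lerDl.
- by apply: rintegrableD; [exact: rintegrable_norm|exact: rintegrable_cst].
Qed.

Lemma Rintegral_off_point f g x : rintegrable g ->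
  (forall t, A t -> t != x -> f t = g t) ->
  \int[mu]_(t in A) f t = \int[mu]_(t in A) g t.
Proof.
move=> ig fg; have if_ := rintegrable_off_point ig fg.
congr fine; apply: ae_eq_integral => //.
- exact: measurable_angles.
- exact: (measurable_int mu if_).
- exact: (measurable_int mu ig).
- by apply: (ae_neq (x0 := x)) => t tx At; rewrite fg.
Qed.

(** Used to substitute the explicit kernels, which fail on the diagonal [t = x] because of the
    default values of [ln] and division. *)
Lemma cintegral_off_point (f g : R -> R[i]) x : cintegrable g ->
  (forall t, A t -> t != x -> f t = g t) -> cintegral f = cintegral g.
Proof.
move=> [a b] fg; rewrite /cintegral; congr (_ +i* _).
- by apply: (Rintegral_off_point (x := x) a) => t At tx; rewrite /= fg.
- by apply: (Rintegral_off_point (x := x) b) => t At tx; rewrite /= fg.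
Qed.

End PointModification.

Section LogPotential.
Context {R : realType}.

Local Open Scope classical_set_scope.
Local Open Scope ring_scope.
Local Notation mu := (@lebesgue_measure R).
Local Notation A := (@angles R).

Lemma ln_sqrt (z : R) : ln (Num.sqrt z) = 2^-1 * ln z.
Proof.
(* For [z <= 0] both sides vanish by the default values of the square root and of [ln]. *)
have [z0|z0] := leP z 0; first by rewrite ler0_sqrtr// !ln0// mulr0.
have s0 : 0 < Num.sqrt z by rewrite sqrtr_gt0.
have : ln (Num.sqrt z ^+ 2) = 2 * ln (Num.sqrt z) by rewrite lnXn// mulr_natl.
by rewrite sqr_sqrtr ?ltW//; lra.
Qed.

(** Think of a point X, a unit vector v and a curve y_t at distance at least [d] from X: [q t] is |X
    - y_t|^2, [b t] is <X - y_t, v>, [bq] is Cauchy-Schwarz, and [Q s t] below is |X + s v -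
    y_t|^2. *)
Variables (q b : R -> R) (d M : R).
Hypotheses (d0 : 0 < d) (mq : measurable_fun A q) (mb : measurable_fun A b).
Hypotheses (dq : forall t, d ^+ 2 <= q t) (qM : forall t, q t <= M).
Hypothesis (bq : forall t, b t ^+ 2 <= q t).

Let Q (s t : R) : R := q t + 2 * s * b t + s ^+ 2.
Let I : set R := `]- (d / 2), (d / 2)[.

Let I_small s : I s -> s ^+ 2 <= d ^+ 2 / 4.
Proof. by rewrite /I/= in_itv/= => /andP[s1 s2]; move: d0; nra. Qed.

(** From (2 s + b)^2 >= 0 and b^2 <= q one gets Q >= q / 2 - s^2; with s^2 <= d^2 / 4, the
    half-width of [I], this is at least d^2 / 4. *)
Let Q_lb s t : I s -> d ^+ 2 / 4 <= Q s t.
Proof.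
move=> /I_small s2; have := dq t; have := bq t; rewrite /Q.
have : 0 <= (2 * s + b t) ^+ 2 by exact: sqr_ge0.
by nra.
Qed.

Let Q_gt0 s t : I s -> 0 < Q s t.
Proof.
move=> Is; apply: lt_le_trans (Q_lb t Is).
by rewrite divr_gt0// exprn_gt0.
Qed.

Let Q_ub s t : I s -> Q s t <= 2 * (M + d ^+ 2).
Proof.
move=> /I_small s2; have := qM t; have := bq t; rewrite /Q.
have : 0 <= (s - b t) ^+ 2 by exact: sqr_ge0.
have : 0 <= d ^+ 2 by exact: sqr_ge0.
by nra.
Qed.

Let mQ s : measurable_fun A (Q s).
Proof.
apply: measurable_funD; last exact: measurable_cst.
by apply: measurable_funD => //; apply: measurable_funM.
Qed.

Let dlog s t : I s ->
  is_derive s 1 (fun s => 2^-1 * ln (Q s t)) ((b t + s) / Q s t).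
Proof.
move=> Is; have Q0 := Q_gt0 t Is.
have dQ : is_derive s 1 (Q ^~ t) (2 * b t + 2 * s).
  by apply: is_derive_eq; rewrite /GRing.scale/=; ring.
have dl := is_derive1_ln Q0.
have dc := @is_derive1_comp _ _ (Q ^~ t) _ _ _ dl dQ.
apply: (@is_derive_eq _ _ _ _ _ _ _ _ (is_deriveZ 2^-1 dc)).
by rewrite /GRing.scale/=; field; rewrite gt_eqF.
Qed.

Lemma log_potential_derive (f : R -> R) : rintegrable f ->
  s^-1 *: ((\int[mu]_(t in A) (2^-1 * ln (q t + 2 * s * b t + s ^+ 2) * f t)) -
           (\int[mu]_(t in A) (2^-1 * ln (q t) * f t))) @[s --> 0^'] -->
  \int[mu]_(t in A) (b t / q t * f t).
Proof.
move=> fi.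
pose F s t := 2^-1 * ln (Q s t) * f t.
have I0 : I 0 by rewrite /I/= in_itv/= oppr_lt0 divr_gt0.
have dF s t : I s -> is_derive s 1 (F ^~ t) ((b t + s) / Q s t * f t).
  move=> Is; have dl := dlog t Is.
  rewrite (_ : F ^~ t = f t \*: (fun s => 2^-1 * ln (Q s t))); last first.
    by apply/funext => u; rewrite /F/= [RHS]mulrC.
  by apply: (@is_derive_eq _ _ _ _ _ _ _ _ (is_deriveZ (f t) dl)); rewrite [LHS]mulrC.
have mln s : measurable_fun A (fun t => 2^-1 * ln (Q s t)).
  apply: measurable_funM => //.
  exact: (measurableT_comp (@measurable_ln R) (mQ s)).
pose L := `|ln (d ^+ 2 / 4)| + `|ln (2 * (M + d ^+ 2))|.
have lnQ s t : I s -> `|2^-1 * ln (Q s t)| <= L.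
  move=> Is; have Q0 := Q_gt0 t Is.
  have d4 : 0 < d ^+ 2 / 4 by rewrite divr_gt0// exprn_gt0.
  have l1 : ln (d ^+ 2 / 4) <= ln (Q s t) by rewrite ler_ln ?posrE// Q_lb.
  have l2 : ln (Q s t) <= ln (2 * (M + d ^+ 2)).
    by rewrite ler_ln ?posrE ?Q_ub// (lt_le_trans Q0)// Q_ub.
  have n1 := ler_norm (- ln (d ^+ 2 / 4)); rewrite normrN in n1.
  have n2 := ler_norm (ln (2 * (M + d ^+ 2))).
  have := normr_ge0 (ln (d ^+ 2 / 4)); have := normr_ge0 (ln (2 * (M + d ^+ 2))).
  rewrite /L ler_norml => p1 p2; apply/andP; split; lra.
have iF s : I s -> rintegrable (F s).
  move=> Is; apply: (@rintegrable_le _ _ (fun t => L * `|f t|)).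
  - by apply: measurable_funM; [exact: mln|exact: rintegrable_measurable].
  - by move=> t At; rewrite normrM ler_wpM2r// lnQ.
  - by apply: rintegrableZ; exact: rintegrable_norm.
(* Since (b + s)^2 <= Q, one has |b + s| <= (1 + Q) / 2; dividing by Q >= d^2 / 4 gives this uniform
   bound of the integrand's derivative factor. *)
pose K := 2 / d ^+ 2 + 2^-1.
have d20 : 0 < d ^+ 2 by exact: exprn_gt0.
have K0 : 0 <= K by rewrite addr_ge0// divr_ge0// ltW.
have bK s t : I s -> `|(b t + s) / Q s t| <= K.
  move=> Is; have Q0 := Q_gt0 t Is.
  have bs : (b t + s) ^+ 2 <= Q s t by rewrite /Q; have := bq t; nra.
  have bs1 : `|b t + s| <= (1 + Q s t) / 2.
    have := sqr_ge0 (`|b t + s| - 1).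
    have : `|b t + s| ^+ 2 <= Q s t by rewrite real_normK ?num_real.
    by nra.
  rewrite normrM normfV (gtr0_norm Q0) ler_pdivrMr// (le_trans bs1)//.
  have QK : 1 / 2 <= 2 / d ^+ 2 * Q s t.
    rewrite mulrAC ler_pdivlMr//; have := Q_lb t Is; lra.
  by rewrite /K mulrDl; lra.
have := @cvg_differentiation_under_integral R _ (measurableTypeR R) mu F A
  (measurable_angles (R:=R)) 0 (- (d / 2)) (d / 2) I0 iF _ (fun t => K * `|f t|).
rewrite /= => H.
have {}H : s^-1 *: ((\int[mu]_(t in A) F (s + 0) t) - \int[mu]_(t in A) F 0 t)
    @[s --> 0^'] --> \int[mu]_(t in A) partial1of2 F 0 t.
  apply: H.
  - by move=> s t Is _; have [] := dF s t Is.
  - by move=> t; rewrite mulr_ge0.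
  - by apply: rintegrableZ; exact: rintegrable_norm.
  - move=> s t Is At; rewrite partial1of2E; have dFs := dF s t Is.
    by rewrite derive_val normrM ler_wpM2r// bK.
have -> : \int[mu]_(t in A) (b t / q t * f t) = \int[mu]_(t in A) partial1of2 F 0 t.
  apply: eq_Rintegral => t _; rewrite partial1of2E; have dF0 := dF 0 t I0.
  by rewrite derive_val /Q mulr0 mul0r expr0n !addr0.
have -> : (\int[mu]_(t in A) (2^-1 * ln (q t) * f t)) = \int[mu]_(t in A) F 0 t.
  by apply: eq_Rintegral => t _; rewrite /F /Q mulr0 mul0r expr0n !addr0.
rewrite (_ : (fun s => _) = (fun s => s^-1 *:
    ((\int[mu]_(t in A) F (s + 0) t) - \int[mu]_(t in A) F 0 t)))//.
by apply/funext => s; rewrite addr0.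
Qed.

End LogPotential.

(** * Convolution with a Fourier kernel *)

Section Convolution.
Context {R : realType}.
Implicit Types (x t : R) (n : int) (w : int -> R) (k : R -> R) (f : R -> R[i]).
Implicit Types (T : nat -> R).

Local Open Scope classical_set_scope.
Local Open Scope ring_scope.
Local Notation mu := (@lebesgue_measure R).
Local Notation A := (@angles R).

Lemma Rintegral_le_cst (g : R -> R) (M : R) : rintegrable g ->
  (forall t, A t -> g t <= M) -> \int[mu]_(t in A) g t <= 2 * pi * M.
Proof.
move=> ig gM; rewrite mulrC -Rintegral_angles_cst; apply: le_Rintegral => //.
- exact: measurable_angles.
- exact: rintegrable_cst.
Qed.

(* Cauchy-Schwarz, from [(norm1 f - c)^2 >= 0] at the mean value [c]. *)
Lemma L1norm_sq_le f (g : R -> R) : cintegrable f -> rintegrable g ->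
  (forall t, A t -> norm1 (f t) ^+ 2 <= g t) ->
  L1norm f ^+ 2 <= 2 * pi * \int[mu]_(t in A) g t.
Proof.
move=> fi gi fg; have p0 : 0 < 2 * pi :> R by rewrite mulr_gt0// pi_gt0.
pose c := L1norm f / (2 * pi).
have ni := norm1_integrable fi.
have : \int[mu]_(t in A) (2 * c * norm1 (f t) - c ^+ 2) <= \int[mu]_(t in A) g t.
  apply: le_Rintegral => //.
  - exact: measurable_angles.
  - apply: rintegrableD; first exact: rintegrableZ.
    exact: rintegrable_cst.
  - move=> t At; rewrite (le_trans _ (fg t At))//.
    by have := sqr_ge0 (norm1 (f t) - c); nra.
rewrite RintegralB; last 3 first.
- exact: measurable_angles.
- exact: rintegrableZ.
- exact: rintegrable_cst.
rewrite RintegralZl//; last exact: measurable_angles.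
rewrite Rintegral_angles_cst -/(L1norm f).
have -> : 2 * c * L1norm f - c ^+ 2 * (2 * pi) = L1norm f ^+ 2 / (2 * pi).
  have pn0 : (pi : R) != 0 by rewrite gt_eqF// pi_gt0.
  by rewrite /c; move: (pi : R) pn0 => p pn0; field.
by rewrite ler_pdivrMr// mulrC.
Qed.

Lemma cintegral_eq0_approx f (F : nat -> R -> R[i]) T (M : R) : cintegrable f ->
  (forall N, cintegrable (F N)) -> (forall N, cintegral (F N) = 0) ->
  T N @[N --> \oo] --> (0 : R) ->
  (forall N t, A t -> norm1 (f t - F N t) <= T N * M) -> cintegral f = 0.
Proof.
move=> fi Fi F0 T0 fF.
apply: (norm1_cvg0 (C := M * (2 * pi)) T0); apply: nearW => N.
have Ni : cintegrable (fun t => - F N t).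
  by under eq_fun do rewrite -mulN1r; exact: cintegrableZ.
have -> : cintegral f = cintegral (fun t => f t - F N t).
  by rewrite cintegralD// cintegralN// F0 subr0.
have di : cintegrable (fun t => f t - F N t) by exact: cintegrableD.
rewrite (le_trans (norm1_cintegral di))// mulrA mulrC.
by apply: Rintegral_le_cst; [exact: norm1_integrable|exact: fF].
Qed.

Variables (k : R -> R) (w : int -> R) (T : nat -> R).
Hypothesis kw : fourier_kernel k w T.

Definition conv f x : R[i] := cintegral (fun t => (k (x - t))%:C * f t).

Definition conv_sum f N x : R[i] :=
  \sum_(n <- ints N) (w n)%:C * expi (n%:~R * x) * fourier_coef f n.

Lemma conv_bounded f : cintegrable f -> exists M, forall x, norm1 (conv f x) <= M.
Proof.
move=> fi; have [M kM] := fourier_kernel_bounded kw; have [mk _ _] := kw.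
exists (M * L1norm f) => x; apply: norm1_cintegralMl => //.
- exact: cmeasurable_kernel.
- by move=> t _; rewrite norm1_real.
Qed.

Lemma cmeasurable_conv_sum f N : cmeasurable (conv_sum f N).
Proof.
apply: cmeasurable_sum => n; apply: cmeasurableM; last exact: cmeasurable_cst.
by apply: cmeasurableM; [exact: cmeasurable_cst|exact: cmeasurable_expiZ].
Qed.

(** The parametric integral is measurable in [x] as the pointwise limit of the trigonometric sums
    [conv_sum]. *)
Lemma cmeasurable_conv f : cintegrable f -> cmeasurable (conv f).
Proof.
move=> fi; have [_ T0 _] := kw.
have TL : T N * L1norm f @[N --> \oo] --> (0 : R).
  by rewrite -(mul0r (L1norm f)); apply: cvgM => //; exact: cvg_cst.
have lim (p : R[i] -> R) : (forall z z', p (z - z') = p z - p z') ->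
    (forall z, `|p z| <= norm1 z) ->
    forall x, p (conv_sum f N x) @[N --> \oo] --> p (conv f x).
  move=> pB pn x; apply/subr_cvg0/norm_cvg0P.
  apply: (@squeeze_cvgr _ _ _ _ (cst 0) (fun N => T N * L1norm f)) => //.
  - apply: nearW => N; rewrite normr_ge0/= distrC -pB (le_trans (pn _))//.
    exact: kernel_approx.
  - exact: cvg_cst.
split.
- apply: (measurable_realfun.measurable_fun_cvg
    (h := fun N => @complex.Re R \o conv_sum f N)).
    by move=> N; have [] := cmeasurable_conv_sum f N.
  move=> x _; apply: lim => [z z'|z]; first by rewrite ReD ReN.
  by rewrite /norm1 lerDl.
- apply: (measurable_realfun.measurable_fun_cvg
    (h := fun N => @complex.Im R \o conv_sum f N)).
    by move=> N; have [] := cmeasurable_conv_sum f N.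
  move=> x _; apply: lim => [z z'|z]; first by rewrite ImD ImN.
  by rewrite /norm1 lerDr.
Qed.

Lemma cintegrable_conv f : cintegrable f -> cintegrable (conv f).
Proof.
move=> fi; have [M fM] := conv_bounded fi.
by apply: (@cintegrable_bounded _ M); [exact: cmeasurable_conv|move=> t _].
Qed.

Lemma fourier_coef0 f : fourier_coef f 0 = cintegral f.
Proof. by apply: eq_cintegral => t _; rewrite mul0r oppr0 expi0 mulr1. Qed.

(** The sums [conv_sum] converge uniformly, and only their term at frequency 0 has a nonzero
    integral; its coefficient is the mean of [f]. *)
Lemma cintegral_conv_eq0 f : cintegrable f -> cintegral f = 0 ->
  cintegral (conv f) = 0.
Proof.
move=> fi f0; have [_ T0 _] := kw.
have ti n : cintegrable (fun x : R =>
    (w n)%:C * expi (n%:~R * x) * fourier_coef f n).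
  under eq_fun do rewrite mulrAC.
  exact/cintegrableZ/cintegrable_expi.
apply: (@cintegral_eq0_approx _ (conv_sum f) T (L1norm f)) => //.
- exact: cintegrable_conv.
- by move=> N; exact: cintegrable_sum.
- move=> N; rewrite cintegral_sum//; apply: big1 => n _.
  under eq_fun do rewrite mulrAC.
  rewrite cintegralZ; last exact: cintegrable_expi.
  rewrite cintegral_expi; have [->|n0] := eqVneq n 0.
    by rewrite fourier_coef0 f0 mulr0 mul0r.
  by rewrite mulr0 mulr0.
- by move=> N x _; exact: kernel_approx.
Qed.

End Convolution.

(** * Tails of the Poisson series over arbitrary finite sets *)

Section PoissonTail.
Context {R : realType}.
Variable rho : R.
Hypothesis r01 : 0 <= rho < 1.
Local Open Scope ring_scope.

Let r0 : 0 <= rho. Proof. by case/andP: r01. Qed.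

Lemma sum_poisson_weight N :
  (1 - rho) * (\sum_(n <- ints N) poisson_weight rho n) =
  1 + rho - 2 * rho ^+ N.+1.
Proof.
have -> : \sum_(n <- ints N) poisson_weight rho n =
    1 + \sum_(0 <= p < N) (2 * rho ^+ p.+1).
  rewrite /ints big_cat !big_map/= big_cons/= /poisson_weight/= expr0 -addrA.
  congr (_ + _); rewrite (iotaDl 1 0 N) big_map -big_split/= /index_iota subn0.
  by apply: eq_bigr => p _; rewrite add1n mulr_natl mulr2n.
elim: N => [|N IH]; first by rewrite big_nil expr1; ring.
rewrite big_nat_recr//= addrA mulrDr IH [rho ^+ N.+2]exprS; ring.
Qed.

(** [s] and [ints N] are disjoint and both lie in a larger symmetric block. The weights being
    nonnegative, the two closed forms of [sum_poisson_weight] bound the sum over [s], whatever [s]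
    is. *)
Lemma sum_poisson_weight_tail N (s : seq int) : uniq s ->
  (forall n, n \in s -> (N < `|n|)%N) ->
  \sum_(n <- s) poisson_weight rho n <= 2 * rho ^+ N.+1 / (1 - rho).
Proof.
move=> us sN; case/andP: (r01) => _ r1.
pose M := (\max_(n <- s) `|n|%N)%N.
have w0 n : 0 <= poisson_weight rho n by exact: exprn_ge0.
have us' : uniq (s ++ ints N).
  rewrite cat_uniq us ints_uniq andbT andTb; apply/hasPn => n.
  by rewrite mem_ints => nN; apply/negP => /sN; rewrite ltnNge nN.
have : \sum_(n <- s ++ ints N) poisson_weight rho n <=
    \sum_(n <- ints (maxn M N)) poisson_weight rho n.
  have sub : {subset s ++ ints N <= ints (maxn M N)}.
    move=> n; rewrite mem_cat !mem_ints leq_max => /orP[ns|->]; last first.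
      by rewrite orbT.
    apply/orP; left; exact: (@leq_bigmax_seq _ s xpredT (fun m : int => `|m|%N) n).
  have /permPl pe : perm_eql (ints (maxn M N))
     ((s ++ ints N) ++ [seq n <- ints (maxn M N) | n \notin s ++ ints N]).
    apply/permPl/uniq_perm.
    - exact: ints_uniq.
    - rewrite cat_uniq us' filter_uniq ?ints_uniq// andbT andTb.
      by apply/hasPn => n; rewrite mem_filter => /andP[].
    - move=> n; rewrite [RHS]mem_cat mem_filter.
      by case: (boolP (n \in s ++ ints N)) => // /sub ->.
  rewrite [leRHS](perm_big _ pe) [leRHS]big_cat lerDl.
  by apply: sumr_ge0 => n _; exact: w0.
rewrite big_cat => H; rewrite ler_pdivlMr ?subr_gt0// mulrC.
have H1 := sum_poisson_weight N; have H2 := sum_poisson_weight (maxn M N).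
have H3 : 0 <= rho ^+ (maxn M N).+1 by exact: exprn_ge0.
have : (1 - rho) * (\sum_(n <- s) poisson_weight rho n +
   \sum_(n <- ints N) poisson_weight rho n) <=
   (1 - rho) * \sum_(n <- ints (maxn M N)) poisson_weight rho n.
  by rewrite ler_wpM2l// subr_ge0 ltW.
rewrite mulrDr H1 H2; lra.
Qed.

(** This gives unconditional convergence. One [kernel_err] pays for the symmetric block [ints N],
    the other for the frequencies of [s] outside it. *)
Lemma norm1_poisson_trigpoly N (s : seq int) x : uniq s -> {subset ints N <= s} ->
  norm1 ((poisson rho x)%:C - trigpoly (poisson_weight rho) s x) <=
  2 * kernel_err rho N.
Proof.
move=> us sub; have [_ _ K] := fourier_kernel_poisson r01.
case/andP: (r01) => _ r1.
pose s' := [seq n <- s | n \notin ints N].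
have pe : perm_eq s (ints N ++ s').
  apply: uniq_perm => //.
  - rewrite cat_uniq ints_uniq filter_uniq// andbT andTb.
    by apply/hasPn => n; rewrite mem_filter => /andP[].
  - move=> n; rewrite [RHS]mem_cat mem_filter.
    by case: (boolP (n \in ints N)) => // /sub ->.
rewrite {1}/trigpoly (perm_big _ pe) big_cat opprD addrA.
rewrite (le_trans (norm1D _ _))// mulr_natl mulr2n lerD//; first exact: K.
rewrite norm1N (le_trans (norm1_trigpoly _ _ _))// -mulr_suml.
have -> : \sum_(n <- s') `|poisson_weight rho n| =
    \sum_(n <- s') poisson_weight rho n.
  by apply: eq_bigr => n _; rewrite ger0_norm// exprn_ge0.
have us' : uniq s' by exact: filter_uniq.
have H : \sum_(n <- s') poisson_weight rho n <= 2 * rho ^+ N.+1 / (1 - rho).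
  apply: sum_poisson_weight_tail => // n.
  by rewrite mem_filter mem_ints -ltnNge => /andP[].
rewrite (le_trans (ler_wpM2r _ H))// /kernel_err.
have d0 : 0 < 1 - rho by rewrite subr_gt0.
have e0 : 0 <= rho ^+ N.+1 by exact: exprn_ge0.
rewrite mulrAC ler_pdivrMr// [leRHS](_ : _ = 4 * rho ^+ N.+1 / (1 - rho)).
  rewrite ler_pdivlMr//; move: r0; nra.
by field; exact: lt0r_neq0.
Qed.

End PoissonTail.

(** * The operator in bipolar coordinates *)

Section NeumannPoincare.
Context {R : realType}.
Variables r eps : R.
Hypotheses (hr : 0 < r) (heps : 0 < eps).
Implicit Types (x t : R) (n : int) (i j : 'I_2) (phi : @density R).

Local Open Scope classical_set_scope.
Local Open Scope ring_scope.
Local Notation mu := (@lebesgue_measure R).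
Local Notation A := (@angles R).
Local Notation al := (alpha r eps).
Local Notation S := (sinh (xi0 r eps)).
Local Notation h0 := (h r eps (xi0 r eps)).
Local Notation rho := (rho r eps).
Local Notation radius := (radius r eps).
Local Notation hg := (h_gt0 hr heps).

(** Density with respect to the angle instead of arc length: f dsigma = [angular f] dt. *)
Definition angular (f : R -> R[i]) t : R[i] := f t * ((h0 t)^-1)%:C.

Lemma lineintE f : lineint r eps f = cintegral (angular f).
Proof. by []. Qed.

Definition energy phi j : R := \int[mu]_(t in A) (normc2 (phi j t) / h0 t).

Lemma L2norm2_energy phi :
  (forall j, rintegrable (fun t => normc2 (phi j t) / h0 t)) ->
  L2norm2 r eps phi = (\sum_(j < 2) energy phi j)%:E.
Proof.
move=> ip; rewrite /L2norm2 -sumEFin; apply: eq_bigr => j _.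
rewrite -[LHS]fineK//.
exact: (integrable_fin_num (measurable_angles (R:=R)) (ip j)).
Qed.

Lemma measurable_hV (D : set R) : measurable_fun D (fun t => (h0 t)^-1).
Proof.
apply: measurable_funTS; apply: continuous_measurable_fun => x.
apply: cvgV; first by rewrite gt_eqF// hg.
apply: cvgM; last exact: cvg_cst.
by apply: cvgB; [exact: cvg_cst|exact: continuous_cos].
Qed.

Lemma measurable_normc2 (f : R -> R[i]) : cmeasurable f ->
  measurable_fun A (fun t => normc2 (f t) / h0 t).
Proof.
move=> [a b]; apply: measurable_funM; last exact: measurable_hV.
by apply: measurable_funD; exact: measurable_funX.
Qed.

Lemma in_L2_energy phi j : in_L2 r eps phi ->
  rintegrable (fun t => normc2 (phi j t) / h0 t).
Proof.
move=> [mp fp]; have mj k := measurable_normc2 (mp k).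
have ge0 k t : (0 <= (normc2 (phi k t) / h0 t)%:E)%E.
  by rewrite lee_fin divr_ge0 ?normc2_ge0// ltW// hg.
apply/integrableP; split; first by apply/measurable_EFinP; exact: mj.
apply: le_lt_trans fp.
apply: (@le_trans _ _ (\int[mu]_(t in A) (normc2 (phi j t) / h0 t)%:E)%E).
  rewrite le_eqVlt; apply/orP; left; apply/eqP; apply: eq_integral => t _.
  exact: (gee0_abs (ge0 j t)).
rewrite /L2norm2 (bigD1 j)//= leeDl// sume_ge0// => k _.
by apply: integral_ge0 => t _.
Qed.

Lemma cmeasurable_hV : cmeasurable (fun t => ((h0 t)^-1)%:C).
Proof.
by apply: cmeasurableR; exact: measurable_hV.
Qed.

(** One of the two factors 1 / h is kept as the weight of the L2 norm, the other is bounded by 1 /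
    [h_min]. *)
Lemma norm1_angular f t : norm1 (angular f t) ^+ 2 <=
  2 / h_min r eps * (normc2 (f t) / h0 t).
Proof.
have h1 := hg t; have h2 := h_min_gt0 hr heps; have h3 := h_ge hr heps t.
have iv : 0 <= (h0 t)^-1 by rewrite invr_ge0 ltW.
rewrite /angular mulrC norm1RM exprMn (ger0_norm iv) exprVn.
have n2 := norm1_le_normc2 (f t); have n0 := normc2_ge0 (f t).
move: (h0 t) (h_min r eps) (normc2 (f t)) h1 h2 h3 iv n2 n0 => a b n a0 b0 ba _ n2 n0.
have -> : 2 / b * (n / a) = (a * b)^-1 * (2 * n) by field; rewrite !lt0r_neq0.
apply: ler_pM => //.
- by rewrite invr_ge0 exprn_ge0// ltW.
- exact: sqr_ge0.
- rewrite lef_pV2 ?posrE ?exprn_gt0 ?mulr_gt0//.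
  by rewrite expr2 ler_wpM2l// ltW.
Qed.

Lemma angular_integrable phi j : in_L2 r eps phi ->
  cintegrable (angular (phi j)).
Proof.
move=> pL; have [mp _] := pL; have ie := in_L2_energy j pL.
apply: (@cintegrable_le _ _ (fun t => 1 + 2 / h_min r eps * (normc2 (phi j t) / h0 t))).
- by apply: cmeasurableM; [exact: mp|exact: cmeasurable_hV].
- move=> t _; have := norm1_angular (phi j) t.
  by have := sqr_ge0 (norm1 (angular (phi j) t) - 1); have := norm1_ge0 (angular (phi j) t); nra.
- by apply: rintegrableD; [exact: rintegrable_cst|exact: rintegrableZ].
Qed.

Lemma L1norm_angular phi j : in_L2 r eps phi ->
  L1norm (angular (phi j)) ^+ 2 <= 2 * pi * (2 / h_min r eps * energy phi j).
Proof.
move=> pL; have ie := in_L2_energy j pL.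
rewrite /energy -RintegralZl//; last exact: measurable_angles.
apply: L1norm_sq_le; first exact: angular_integrable.
- exact: rintegrableZ.
- by move=> t _; exact: norm1_angular.
Qed.

Lemma neq_ord2 i j k : i != j -> (k != i) = (k == j).
Proof. by case: i j k => [[|[|//]] ?] [[|[|//]] ?] [[|[|//]] ?]. Qed.

Lemma npdisk_eq0 (f : R -> R[i]) i x : cintegrable (angular f) ->
  lineint r eps f = 0 -> A x -> npdisk r eps i f (bdry r eps i x) = 0.
Proof.
move=> fi f0 Ax; rewrite /npdisk lineintE /angular.
rewrite (@cintegral_off_point _ _ (fun t => ((2 * r)^-1)%:C * angular f t) x).
- by rewrite cintegralZ// -lineintE f0 !mulr0.
- exact: cintegrableZ.
- by move=> t At tx; rewrite np_kernel_same// mulrA.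
Qed.

Lemma dot2_sq_le (u v : R * R) : dot2 v v = 1 -> dot2 u v ^+ 2 <= dot2 u u.
Proof.
case: u => a b; case: v => c d; rewrite /dot2/= => H.
have -> : a * a + b * b = (a * a + b * b) * (c * c + d * d) by rewrite H mulr1.
by have := sqr_ge0 (a * d - b * c); nra.
Qed.

Lemma dot2_shift (s : R) (v p p' : R * R) : dot2 v v = 1 ->
  dot2 (s *: v + p - p') (s *: v + p - p') =
  dot2 (p - p') (p - p') + 2 * s * dot2 (p - p') v + s ^+ 2.
Proof.
case: v => a b; case: p => p1 p2; case: p' => q1 q2; rewrite /dot2/= => vv.
transitivity ((p1 - q1) * (p1 - q1) + (p2 - q2) * (p2 - q2) +
   2 * s * ((p1 - q1) * a + (p2 - q2) * b) + s ^+ 2 * (a * a + b * b)).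
  by rewrite /GRing.scale/=; ring.
by rewrite vv mulr1.
Qed.

(** Real version, for the two components of [cderive]. The point stays away from the other circle,
    so one may differentiate under the integral; the constant [c] stands for the prefactor of
    [slp]. *)
Lemma derive_log_dist (c : R) (g : R -> R) i j x : i != j -> A x -> rintegrable g ->
  'D_(normal r eps i (bdry r eps i x))
    (fun y => c * \int[mu]_(t in A) (ln (enorm (y - bdry r eps j t)) * g t))
    (bdry r eps i x) =
  c * \int[mu]_(t in A)
    ((S / (2 * al) - h0 x / 2 * poisson rho (x - t)) * g t).
Proof.
move=> ij Ax gi; set X := bdry r eps i x; set v := normal r eps i X.
have vv : dot2 v v = 1 by exact: normal_unit.
pose q t := dot2 (X - bdry r eps j t) (X - bdry r eps j t).
pose b t := dot2 (X - bdry r eps j t) v.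
pose K t := S / (2 * al) - h0 x / 2 * poisson rho (x - t).
have bK t : b t / q t = K t by exact: np_kernel_diff.
have rho0 := rho_gt0 r eps; have rho1 := rho_lt1 hr heps.
have hm0 := h_min_gt0 hr heps; have hM0 := h_max_gt0 hr heps.
have qE t : q t = qpol rho (x - t) / (rho * h0 x * h0 t).
  by rewrite /q dist2E// /radius (negbTE ij).
have P0 t : 0 < rho * h0 x * h0 t by exact: (mulr_gt0 (mulr_gt0 rho0 (hg x)) (hg t)).
have q0 t : 0 < q t by rewrite qE divr_gt0// qpol_gt0// ltW.
have mq : measurable_fun A q.
  rewrite (_ : q = fun t => qpol rho (x - t) * ((rho * h0 x)^-1 * (h0 t)^-1)); last first.
    by apply/funext => t; rewrite qE invfM.
  apply: measurable_funM.
    apply: (measurableT_comp (measurable_qpol rho)).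
    by under eq_fun do rewrite addrC -mulN1r; exact: measurable_affine.
  by apply: measurable_funM; [exact: measurable_cst|exact: measurable_hV].
have mK : measurable_fun A K.
  have [mP _ _] := fourier_kernel_poisson (rho01 hr heps).
  apply: measurable_funB; first exact: measurable_cst.
  apply: measurable_funM; first exact: measurable_cst.
  apply: (measurableT_comp mP).
  by under eq_fun do rewrite addrC -mulN1r; exact: measurable_affine.
(* By [bK], [b] is the product of [K] and [q], already known to be measurable. *)
have mb : measurable_fun A b.
  rewrite (_ : b = fun t => K t * q t); first exact: measurable_funM.
  by apply/funext => t; rewrite -bK divfK// gt_eqF.
(* A lower bound of the distance: [qpol] is at least (1 - rho)^2, and [rho * h0 x * h0 t] at most
   the square of [h_max]. *)
pose d := (1 - rho) / h_max r eps.
have d0 : 0 < d by rewrite divr_gt0// subr_gt0.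
have dq t : d ^+ 2 <= q t.
  rewrite qE /d exprMn ler_pM ?sqr_ge0// ?qpol_ge ?(ltW rho0)//.
  rewrite exprVn lef_pV2 ?posrE ?exprn_gt0//.
  have hx := h_le hr heps x; have ht := h_le hr heps t.
  have : h0 x * h0 t <= h_max r eps ^+ 2.
    by rewrite expr2 ler_pM// ltW// hg.
  have : 0 <= h0 x * h0 t by exact: (mulr_ge0 (ltW (hg x)) (ltW (hg t))).
  rewrite -mulrA; move: (h0 x * h0 t) => p p0 pM.
  by rewrite (le_trans _ pM)// ler_piMl// ltW.
pose M := 4 / (rho * h_min r eps ^+ 2).
have qM t : q t <= M.
  rewrite qE /M ler_pM ?invr_ge0 ?(ltW (P0 t))//.
  - by rewrite ltW// qpol_gt0// ltW.
  - by rewrite qpol_le4// !ltW.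
  - have P1 : 0 < rho * h_min r eps ^+ 2.
      exact: (mulr_gt0 rho0 (exprn_gt0 2 hm0)).
    have P2 := P0 t; rewrite lef_pV2 ?posrE//.
    have hx := h_ge hr heps x; have ht := h_ge hr heps t.
    by rewrite -mulrA expr2 ler_pM2l// ler_pM ?(ltW hm0).
have bq t : b t ^+ 2 <= q t by exact: dot2_sq_le.
have H := log_potential_derive d0 mq mb dq qM bq gi.
rewrite /derive; apply: cvg_lim => //.
have {}H : c * (s^-1 *:
    ((\int[mu]_(t in A) (2^-1 * ln (q t + 2 * s * b t + s ^+ 2) * g t)) -
     (\int[mu]_(t in A) (2^-1 * ln (q t) * g t)))) @[s --> 0^'] -->
    c * \int[mu]_(t in A) (K t * g t).
  apply: cvgM; first exact: cvg_cst.
  by under [X in _ --> X]eq_Rintegral do rewrite -bK.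
apply: cvg_trans H; apply: near_eq_cvg; apply: nearW => s /=.
rewrite /GRing.scale/= mulrCA -mulrBr; apply/esym; congr (_ * (_ * (_ - _))).
- apply: eq_Rintegral => t _; rewrite /enorm ln_sqrt; congr (_ * ln _ * _).
  exact: dot2_shift.
- by apply: eq_Rintegral => t _; rewrite /enorm ln_sqrt.
Qed.

Lemma cderive_slp (f : R -> R[i]) i j x : i != j -> A x ->
  cintegrable (angular f) -> lineint r eps f = 0 ->
  cderive (slp r eps j f) (normal r eps i (bdry r eps i x)) (bdry r eps i x) =
  (- (h0 x / (4 * pi)))%:C * conv (poisson rho) (angular f) x.
Proof.
move=> ij Ax fi f0; have [fr fim] := fi.
pose K t := S / (2 * al) - h0 x / 2 * poisson rho (x - t).
have Pi : cintegrable (fun t => (poisson rho (x - t))%:C * angular f t).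
  exact: (cintegrable_kernel x (fourier_kernel_poisson (rho01 hr heps)) fi).
have Re_slp y : complex.Re (slp r eps j f y) = (2 * pi)^-1 *
    \int[mu]_(t in A) (ln (enorm (y - bdry r eps j t)) * complex.Re (angular f t)).
  rewrite /slp ReRM /=; congr (_ * _); apply: eq_Rintegral => t _.
  by rewrite -mulrA ReRM.
have Im_slp y : complex.Im (slp r eps j f y) = (2 * pi)^-1 *
    \int[mu]_(t in A) (ln (enorm (y - bdry r eps j t)) * complex.Im (angular f t)).
  rewrite /slp ImRM /=; congr (_ * _); apply: eq_Rintegral => t _.
  by rewrite -mulrA ImRM.
transitivity (((2 * pi)^-1)%:C * cintegral (fun t => (K t)%:C * angular f t)).
  rewrite /cderive (funext Re_slp) (funext Im_slp).
  rewrite (derive_log_dist _ ij Ax fr) (derive_log_dist _ ij Ax fim).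
  apply: complexP; rewrite ?ReRM ?ImRM/=.
  - by congr (_ * _); apply: eq_Rintegral => t _; rewrite ReRM.
  - by congr (_ * _); apply: eq_Rintegral => t _; rewrite ImRM.
have -> : cintegral (fun t => (K t)%:C * angular f t) =
    cintegral (fun t => (S / (2 * al))%:C * angular f t +
      (- (h0 x / 2))%:C * ((poisson rho (x - t))%:C * angular f t)).
  apply: eq_cintegral => t _.
  by rewrite mulrA -rmorphM -mulrDl -rmorphD mulNr.
rewrite cintegralD; [|exact: cintegrableZ|exact: cintegrableZ].
(* Mean zero removes the constant part of the kernel. *)
rewrite !cintegralZ// -lineintE f0 mulr0 add0r mulrA -rmorphM; congr (_%:C * _).
have pn0 : (pi : R) != 0 by rewrite gt_eqF// pi_gt0.
by move: (pi : R) pn0 => p pn0; field.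
Qed.

Lemma npopE phi i j x : i != j -> A x -> in_L20 r eps phi ->
  npop r eps phi i x =
  (- (h0 x / (4 * pi)))%:C * conv (poisson rho) (angular (phi j)) x.
Proof.
move=> ij Ax [pL p0]; rewrite /npop (bigD1 i)//= eqxx (big_pred1 j); last first.
  by move=> k /=; rewrite (neq_ord2 k ij).
rewrite npdisk_eq0//; last exact: angular_integrable.
rewrite add0r eq_sym (negbTE ij) cderive_slp//; exact: angular_integrable.
Qed.

End NeumannPoincare.

(** * Eigenvectors *)

Section Eigenvectors.
Context {R : realType}.
Variables r eps : R.
Hypotheses (hr : 0 < r) (heps : 0 < eps).
Implicit Types (x t : R) (n m : int) (i j : 'I_2) (phi : @density R) (s : bool).

Local Open Scope classical_set_scope.
Local Open Scope ring_scope.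
Local Notation mu := (@lebesgue_measure R).
Local Notation A := (@angles R).
Local Notation h0 := (h r eps (xi0 r eps)).
Local Notation rho := (rho r eps).
Local Notation radius := (radius r eps).
Local Notation ang := (angular r eps).
Local Notation hg := (h_gt0 hr heps).

(** Sign pattern of [Psi s n] over the two circles: (1, -1) for the sign +, (1, 1) for the sign
    -. *)
Definition tau s j : R := if j == ord0 then 1 else - (-1) ^+ s.

(** In [slop_Psi] the 1 comes from a circle acting on itself and the power of [rho] from the other
    circle. *)
Definition gap s n : R := 1 - (-1) ^+ s * rho ^+ `|n|%N.

Definition Psi_cst s n : R :=
  Num.sqrt `|n|%:~R / Num.sqrt (2 * pi * gap s n).

Lemma tau_neq s i j : i != j -> tau s j = - (-1) ^+ s * tau s i.
Proof.
rewrite /tau; case: i j => [[|[|//]] ?] [[|[|//]] ?]//= _; rewrite ?mulr1//.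
by case: s; rewrite /= ?expr1 ?expr0; ring.
Qed.

Lemma tau2 s i : tau s i ^+ 2 = 1.
Proof. by rewrite /tau; case: ifP; rewrite ?expr1n// sqrrN sqrr_sign. Qed.

Lemma normr_tau s i : `|tau s i| = 1.
Proof. by rewrite /tau; case: ifP; rewrite ?normr1// normrN normr_sign. Qed.

Lemma gap_gt0 s n : n != 0 -> 0 < gap s n.
Proof.
move=> n0; have r1 : rho ^+ `|n|%N < 1.
  rewrite exprn_ilt1 ?rho_lt1 ?ltW ?rho_gt0// absz_eq0 n0//.
have r0 : 0 <= rho ^+ `|n|%N by rewrite exprn_ge0// ltW// rho_gt0.
by rewrite /gap; case: s; rewrite /= ?expr1 ?expr0; lra.
Qed.

Lemma absz_gt0R n : n != 0 -> 0 < `|n|%N%:R :> R.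
Proof. by move=> n0; rewrite ltr0n absz_gt0. Qed.

Lemma Psi_cst2 s n : n != 0 ->
  Psi_cst s n ^+ 2 = `|n|%N%:R / (2 * pi * gap s n).
Proof.
move=> n0; have g0 := gap_gt0 s n0.
rewrite /Psi_cst expr_div_n !sqr_sqrtr ?natr_absz//.
by rewrite mulr_ge0 ?ltW// mulr_gt0// pi_gt0.
Qed.

Lemma PsiE s n j t :
  Psi r eps s n j t = (Psi_cst s n * tau s j * h0 t)%:C * expi (n%:~R * t).
Proof.
rewrite /Psi rho_expE -/(gap s n) -/(Psi_cst s n) mulrAC -rmorphM hN /tau.
by congr (_%:C * _); case: ifP => _; rewrite ?mulr1// -mulNr mulrA.
Qed.

Lemma angular_Psi s n j : ang (Psi r eps s n j) =
  (fun t => (Psi_cst s n * tau s j)%:C * expi (n%:~R * t)).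
Proof.
apply/funext => t; rewrite /angular PsiE mulrAC -rmorphM mulfK//.
by rewrite gt_eqF// hg.
Qed.

Lemma L2norm2_bounded phi (M : R) : (forall j, cmeasurable (phi j)) ->
  (forall j t, A t -> norm1 (phi j t) <= M) -> in_L2 r eps phi.
Proof.
move=> mp pM; split; first exact: mp.
rewrite L2norm2_energy ?ltry// => j.
apply: (@rintegrable_bounded _ (M ^+ 2 / h_min r eps)).
  exact: measurable_normc2.
move=> t At; have M0 : 0 <= M by rewrite (le_trans (norm1_ge0 _) (pM j t At)).
have h1 := hg t; have h2 := h_min_gt0 hr heps; have h3 := h_ge hr heps t.
rewrite (ger0_norm (divr_ge0 (normc2_ge0 (phi j t)) (ltW h1))).
rewrite ler_pM ?normc2_ge0 ?invr_ge0 ?(ltW h1)//.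
- rewrite (le_trans (normc2_le_norm1 _))// lerXn2r ?nnegrE ?norm1_ge0//.
  exact: pM.
- by rewrite lef_pV2 ?posrE.
Qed.

Lemma Psi_in_L20 s n : n != 0 -> in_L20 r eps (Psi r eps s n).
Proof.
move=> n0; split.
- apply: (@L2norm2_bounded _ (`|Psi_cst s n| * h_max r eps * 2)) => [j|j t _].
    rewrite (_ : Psi r eps s n j = fun t =>
        (Psi_cst s n * tau s j * h0 t)%:C * expi (n%:~R * t)); last first.
      by apply/funext => t; rewrite PsiE.
    apply: cmeasurableM; last exact: cmeasurable_expiZ.
    apply: cmeasurableR; apply: measurable_funM; first exact: measurable_cst.
    by apply: measurable_funTS; exact: measurable_h.
  rewrite PsiE norm1RM [X in X * _]normrM (gtr0_norm (hg t)) normrM normr_tau mulr1.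
  rewrite ler_pM ?norm1_ge0 ?norm1_expi//; last by rewrite ler_wpM2l ?h_le.
  by rewrite mulr_ge0// ltW// hg.
- move=> j; rewrite lineintE angular_Psi cintegralZ; last exact: cintegrable_expi.
  by rewrite cintegral_expi (negbTE n0) mulr0 mulr0.
Qed.

Lemma npop_Psi s n j t : n != 0 -> A t ->
  npop r eps (Psi r eps s n) j t = (eigval r eps s n)%:C * Psi r eps s n j t.
Proof.
move=> n0 At; have [i ji] : exists i, j != i.
  by case: j => [[|[|//]] jlt]; [exists ord_max|exists ord0].
rewrite (npopE hr heps ji At (Psi_in_L20 s n0)) angular_Psi /conv.
under eq_cintegral do rewrite mulrCA.
have kp := fourier_kernel_poisson (rho01 hr heps).
rewrite cintegralZ; last exact: (cintegrable_kernel t kp (cintegrable_expi _)).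
rewrite (kernel_expi n t kp) PsiE /eigval rho_expE /poisson_weight.
move: (h0 t) => a; rewrite !mulrA -!rmorphM; congr (_%:C * _).
(* The minus sign of [tau_neq] meets that of the kernel, leaving the sign of [eigval]. *)
rewrite (tau_neq s ji).
have pn0 : (pi : R) != 0 by rewrite gt_eqF// pi_gt0.
by move: (pi : R) pn0 => p pn0; field.
Qed.

Lemma log_radius_expi i j n x : A x ->
  cintegral (fun t => (log_qpol (radius i j) (x - t))%:C * expi (n%:~R * t)) =
  (2 * pi * log_weight (radius i j) n)%:C * expi (n%:~R * x).
Proof.
move=> Ax; rewrite /radius; case: ifP => _; first exact: log_qpol1_expi.
exact: (kernel_expi n x (fourier_kernel_log (rho01 hr heps))).
Qed.

Lemma log_radius_integrable i j n x : A x ->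
  cintegrable (fun t => (log_qpol (radius i j) (x - t))%:C * expi (n%:~R * t)).
Proof.
move=> Ax; rewrite /radius; case: ifP => _; last first.
  exact: (cintegrable_kernel x (fourier_kernel_log (rho01 hr heps)) (cintegrable_expi _)).
under eq_fun do rewrite mulrC; apply: (@cintegrableMl _ 2).
- exact: cmeasurable_expiZ.
- by move=> t _; exact: norm1_expi.
- split; first exact: log_qpol1_integrable.
  by apply: (eq_rintegrable (f := fun=> 0)) => //; exact: rintegrable_cst.
Qed.

(** Contribution of [ln (h0 t)] from [ln_dist]. It is constant in [x], so its value never has to be
    computed. *)
Definition log_h_coef n : R[i] :=
  cintegral (fun t => (ln (h0 t))%:C * expi (n%:~R * t)).

Lemma log_h_integrable n :
  cintegrable (fun t => (ln (h0 t))%:C * expi (n%:~R * t)).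
Proof.
apply: (@cintegrableMl _ (`|ln (h_min r eps)| + `|ln (h_max r eps)|)).
- apply: cmeasurableR; apply: (measurableT_comp (@measurable_ln R)).
  by apply: measurable_funTS; exact: measurable_h.
- move=> t _; rewrite norm1_real.
  have h1 := hg t; have h2 := h_min_gt0 hr heps; have h4 := h_max_gt0 hr heps.
  have l1 : ln (h_min r eps) <= ln (h0 t) by rewrite ler_ln ?posrE// h_ge.
  have l2 : ln (h0 t) <= ln (h_max r eps) by rewrite ler_ln ?posrE// h_le.
  have n1 := ler_norm (- ln (h_min r eps)); rewrite normrN in n1.
  have n2 := ler_norm (ln (h_max r eps)).
  have n3 := normr_ge0 (ln (h_min r eps)); have n4 := normr_ge0 (ln (h_max r eps)).
  by rewrite ler_norml; apply/andP; split; lra.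
- exact: cintegrable_expi.
Qed.

Lemma slp_Psi s n i j x : n != 0 -> A x ->
  slp r eps j (Psi r eps s n j) (bdry r eps i x) =
  (2^-1 * Psi_cst s n * tau s j)%:C *
    ((log_weight (radius i j) n)%:C * expi (n%:~R * x) -
     ((2 * pi)^-1)%:C * log_h_coef n).
Proof.
move=> n0 Ax; pose c := Psi_cst s n * tau s j.
(* The terms of [ln_dist] that are constant in [t]; they integrate to 0 against the exponential
   since [n != 0]. *)
pose C := - ln (radius i j) - ln (h0 x).
rewrite /slp lineintE.
rewrite (@cintegral_off_point _ _ (fun t => (c / 2)%:C *
   ((log_qpol (radius i j) (x - t))%:C * expi (n%:~R * t) +
    (C%:C * expi (n%:~R * t) - (ln (h0 t))%:C * expi (n%:~R * t)))) x); first 1 last.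
- apply: cintegrableZ; apply: cintegrableD; first exact: log_radius_integrable.
  apply: cintegrableD; first exact/cintegrableZ/cintegrable_expi.
  by under eq_fun do rewrite -mulN1r; exact/cintegrableZ/log_h_integrable.
- move=> t At tx.
  have q0 : 0 < qpol (radius i j) (x - t).
    rewrite /radius; case: ifP => _; first exact: qpol1_gt0.
    exact: (qpol_gt0 _ (rho01 hr heps)).
  rewrite /angular -mulrA -/(angular r eps (Psi r eps s n j) t) angular_Psi.
  rewrite ln_dist// -/c -mulrBl -mulrDl -rmorphB -rmorphD !mulrA -!rmorphM.
  by congr (_%:C * _); rewrite /C /=; field.
have iN : cintegrable (fun t => - ((ln (h0 t))%:C * expi (n%:~R * t))).
  by under eq_fun do rewrite -mulN1r; exact/cintegrableZ/log_h_integrable.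
have iC : cintegrable (fun t => C%:C * expi (n%:~R * t)).
  exact/cintegrableZ/cintegrable_expi.
have iL := log_radius_integrable i j n Ax.
rewrite cintegralZ; last exact/cintegrableD/cintegrableD.
rewrite cintegralD; [|exact: iL|exact: cintegrableD].
rewrite cintegralD// cintegralN; last exact: log_h_integrable.
rewrite cintegralZ ?cintegral_expi ?(negbTE n0); last exact: cintegrable_expi.
rewrite log_radius_expi// -/(log_h_coef n) mulr0 mulr0 add0r.
rewrite /c; move: (Psi_cst s n) (tau s j) => a b.
rewrite mulrA -rmorphM !mulrBr !mulrA -!rmorphM.
have pn0 : (pi : R) != 0 by rewrite gt_eqF// pi_gt0.
by congr (_%:C * _ - _%:C * _); move: (pi : R) pn0 => p pn0; field.
Qed.

(** The same constant on both circles, removed in [HdotE] by the mean zero of [phi]. *)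
Definition slop_cst s n : R[i] :=
  \sum_(j < 2) - ((2^-1 * Psi_cst s n * tau s j)%:C *
    (((2 * pi)^-1)%:C * log_h_coef n)).

Lemma slop_Psi s n i x : n != 0 -> A x ->
  slop r eps (Psi r eps s n) i x =
  (- (Psi_cst s n * tau s i * gap s n / (2 * `|n|%N%:R)))%:C * expi (n%:~R * x)
  + slop_cst s n.
Proof.
move=> n0 Ax; rewrite /slop.
under eq_bigr do rewrite slp_Psi// mulrBr.
rewrite big_split/=; congr (_ + _).
have [j ij] : exists j, i != j.
  by case: i => [[|[|//]] jlt]; [exists ord_max|exists ord0].
rewrite (bigD1 i)//= (big_pred1 j); last by move=> k /=; rewrite (neq_ord2 k ij).
rewrite /log_weight /radius eqxx (negbTE ij) expr1n (tau_neq s ij) /gap.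
have := absz_gt0R n0.
move: (`|n|%N%:R : R) (Psi_cst s n) (tau s i) ((-1) ^+ s : R) (rho ^+ _)
  => N c a u q N0.
rewrite !mulrA -!rmorphM -mulrDl -rmorphD; congr (_%:C * _).
by field; rewrite gt_eqF.
Qed.

Lemma HdotE s n phi : n != 0 -> in_L20 r eps phi ->
  Hdot r eps phi (Psi r eps s n) =
  (Psi_cst s n * gap s n / (2 * `|n|%N%:R))%:C *
  \sum_(i < 2) (tau s i)%:C * fourier_coef (ang (phi i)) n.
Proof.
move=> n0 [pL p0]; rewrite /Hdot /ldot -sumrN mulr_sumr; apply: eq_bigr => i _.
have fi := angular_integrable hr heps i pL.
pose a := - (Psi_cst s n * tau s i * gap s n / (2 * `|n|%N%:R)).
rewrite lineintE (eq_cintegral (g := fun t =>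
   a%:C * (ang (phi i) t * expi (- (n%:~R * t))) +
   (slop_cst s n)^* * ang (phi i) t)); last first.
  move=> t At; rewrite /angular slop_Psi// rmorphD rmorphM/= conj_expi -/a.
  by rewrite [(a%:C)^*]conjc_real; ring.
rewrite cintegralD; last 2 first.
- exact/cintegrableZ/cintegrable_coef.
- exact: cintegrableZ.
rewrite !cintegralZ//; last exact: cintegrable_coef.
rewrite -lineintE p0 mulr0 addr0 -/(fourier_coef _ _) mulrA -rmorphM -mulNr -rmorphN.
by congr (_%:C * _); rewrite /a opprK; ring.
Qed.

(** Different frequencies are separated by Fourier orthogonality, different signs by the sum of
    [tau s i * tau s' i], which is 1 - 1. For equal indices that sum is 2, and [Psi_cst2] makes the
    product 1. *)
Lemma Psi_orthonormal s s' m n : m != 0 -> n != 0 ->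
  Hdot r eps (Psi r eps s m) (Psi r eps s' n) = ((s == s') && (m == n))%:R.
Proof.
move=> m0 n0; rewrite HdotE//; last exact: Psi_in_L20.
have coefE i : fourier_coef (ang (Psi r eps s m i)) n =
    (Psi_cst s m * tau s i * (2 * pi * (n == m)%:R))%:C.
  rewrite angular_Psi; transitivity ((Psi_cst s m * tau s i)%:C *
      fourier_coef (fun t => expi (m%:~R * t)) n).
    rewrite /fourier_coef -cintegralZ; first by apply: eq_cintegral => t _; rewrite mulrA.
    exact/cintegrable_coef/cintegrable_expi.
  by rewrite fourier_coef_expi -rmorphM.
under eq_bigr do rewrite coefE -rmorphM.
rewrite -rmorph_sum -rmorphM -[RHS](rmorph_nat (real_complex R)); congr (_%:C).
rewrite eq_sym; have [nm|_] := eqVneq n m; last first.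
  by rewrite andbF mulr0n big1 ?mulr0// => i _; rewrite !mulr0.
rewrite andbT -nm !big_ord_recl big_ord0 /tau/= !mulr1 addr0.
have := Psi_cst2 s n0; have := gap_gt0 s n0; have := absz_gt0R n0.
have [<-|ss'] := eqVneq s s'.
- have s2 : ((-1) ^+ s) ^+ 2 = 1 :> R by rewrite sqrr_sign.
  have := pi_gt0 R.
  move: (Psi_cst s n) (gap s n) (`|n|%N%:R) ((-1) ^+ s) (pi : R) s2
    => c g a u p u2 p0 a0 g0 c2.
  rewrite mulr1n; transitivity (c ^+ 2 * (2 * p * g) * (1 + u ^+ 2) / (2 * a)).
    by field; rewrite gt_eqF.
  by rewrite c2 u2; field; rewrite !lt0r_neq0.
- have -> : - (-1) ^+ s' = (-1) ^+ s :> R.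
    by move: ss'; clear coefE; case: s; case: s' => //= _; rewrite ?expr1 ?expr0 ?opprK.
  have s2 : ((-1) ^+ s) ^+ 2 = 1 :> R by rewrite sqrr_sign.
  move=> _ _ _; rewrite mulr0n; set c := (X in X * _); set d := Psi_cst s n.
  transitivity (c * (d * (2 * pi) * (1 - ((-1) ^+ s) ^+ 2))); first by ring.
  by rewrite s2 subrr !mulr0.
Qed.

End Eigenvectors.

(** * Convergence of the spectral series *)

Section SpectralDecomposition.
Context {R : realType}.
Variables r eps : R.
Hypotheses (hr : 0 < r) (heps : 0 < eps).
Implicit Types (x t : R) (n : int) (N : nat) (i j : 'I_2) (phi : @density R).
Implicit Types (s : bool) (F G : {fset int}).

Local Open Scope classical_set_scope.
Local Open Scope ring_scope.
Local Notation mu := (@lebesgue_measure R).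
Local Notation A := (@angles R).
Local Notation h0 := (h r eps (xi0 r eps)).
Local Notation rho := (rho r eps).
Local Notation ang := (angular r eps).
Local Notation hg := (h_gt0 hr heps).
Local Notation P := (poisson rho).
Local Notation w := (poisson_weight rho).
Local Notation kP := (fourier_kernel_poisson (rho01 hr heps)).
Local Notation err := (kernel_err rho).

Let pi0 : 0 < pi :> R. Proof. exact: pi_gt0. Qed.
Let pin0 : (pi : R) != 0. Proof. by rewrite gt_eqF. Qed.

Let exists_neq j : exists i, j != i.
Proof. by case: j => [[|[|//]] jlt]; [exists ord_max|exists ord0]. Qed.

Lemma eq_cmeasurable (f g : R -> R[i]) : (forall t, A t -> f t = g t) ->
  cmeasurable f -> cmeasurable g.
Proof.
move=> fg [a b]; split.
- by apply: eq_measurable_fun a => t /set_mem /fg /= ->.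
- by apply: eq_measurable_fun b => t /set_mem /fg /= ->.
Qed.

(** The factor [h0] of [npopE] cancels against the arc length element, so the mean of the image is
    that of a convolution, up to a constant. *)
Lemma npop_in_L20 phi : in_L20 r eps phi -> in_L20 r eps (npop r eps phi).
Proof.
move=> pL20; have [pL p0] := pL20; have fi i := angular_integrable hr heps i pL.
have /choice[M HM] : forall i, exists M, forall x, norm1 (conv P (ang (phi i)) x) <= M.
  by move=> i; exact: (conv_bounded kP).
split.
- apply: (L2norm2_bounded hr heps
    (M := h_max r eps / (4 * pi) * \sum_(i < 2) `|M i|)) => [j|j t At].
    have [i ji] := exists_neq j.
    apply: (eq_cmeasurable (f := fun t =>
        (- (h0 t / (4 * pi)))%:C * conv P (ang (phi i)) t)).
      by move=> t At; rewrite (npopE hr heps ji At pL20).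
    apply: cmeasurableM; last exact: (cmeasurable_conv kP).
    apply: cmeasurableR; rewrite (_ : (fun t => _) =
        fun t => - (4 * pi)^-1 * h0 t); last by apply/funext => t; ring.
    apply: measurable_funM; first exact: measurable_cst.
    by apply: measurable_funTS; exact: measurable_h.
  have [i ji] := exists_neq j.
  have p4 : 0 < 4 * pi :> R by rewrite mulr_gt0.
  have h4 : 0 <= h0 t / (4 * pi) by exact: (divr_ge0 (ltW (hg t)) (ltW p4)).
  rewrite (npopE hr heps ji At pL20) norm1RM normrN (ger0_norm h4).
  rewrite ler_pM ?norm1_ge0//.
    by rewrite ler_pM2r ?invr_gt0 ?mulr_gt0// h_le.
  rewrite (le_trans (HM i t))// (bigD1 i)//= (le_trans (ler_norm _))// lerDl.
  exact: sumr_ge0.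
- move=> j; have [i ji] := exists_neq j.
  rewrite lineintE (eq_cintegral
      (g := fun t => (- (4 * pi)^-1)%:C * conv P (ang (phi i)) t)).
    rewrite cintegralZ; last exact: (cintegrable_conv kP).
    by rewrite (cintegral_conv_eq0 kP) ?mulr0// -lineintE p0.
  move=> t At; rewrite /angular (npopE hr heps ji At pL20) mulrAC -rmorphM.
  congr (_%:C * _); have := hg t; move: (h0 t) (pi : R) pin0 => a p p0' a0.
  by field; rewrite p0' gt_eqF.
Qed.

Variable phi : @density R.
Hypothesis phiL : in_L20 r eps phi.

Let fi i : cintegrable (ang (phi i)).
Proof. by case: phiL => pL _; exact: angular_integrable. Qed.

Let f0 i : cintegral (ang (phi i)) = 0.
Proof. by case: phiL => _ p0; rewrite -lineintE p0. Qed.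

(* [ang (phi j)] is half the sum over [s] of [tau s j * parity_part s], and
   [Psi s n] only sees [parity_part s]. *)
Definition parity_part s t : R[i] := \sum_(i < 2) (tau s i)%:C * ang (phi i) t.
Local Notation g := parity_part.

Lemma parity_part_integrable s : cintegrable (g s).
Proof. by apply: cintegrable_sum => i; exact: cintegrableZ. Qed.

Lemma L1norm_parity_part s : L1norm (g s) <= \sum_(i < 2) L1norm (ang (phi i)).
Proof.
have ni i := norm1_integrable (fi i).
rewrite !big_ord_recl big_ord0 addr0 /L1norm.
rewrite -RintegralD; [|exact: measurable_angles|exact: ni|exact: ni].
apply: le_Rintegral.
- exact: measurable_angles.
- exact: (norm1_integrable (parity_part_integrable s)).
- exact: (rintegrableD (ni _) (ni _)).
- move=> t _; rewrite (le_trans (norm1_sum _ _))// !big_ord_recl big_ord0 addr0.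
  by rewrite !norm1RM !normr_tau !mul1r.
Qed.

Lemma fourier_coef_parity_part s n :
  fourier_coef (g s) n = \sum_(i < 2) (tau s i)%:C * fourier_coef (ang (phi i)) n.
Proof.
rewrite /fourier_coef (eq_cintegral (g := fun t =>
  \sum_(i < 2) (tau s i)%:C * (ang (phi i) t * expi (- (n%:~R * t))))).
  rewrite cintegral_sum => [|i]; last exact/cintegrableZ/cintegrable_coef.
  by apply: eq_bigr => i _; rewrite cintegralZ//; exact: cintegrable_coef.
by move=> t _; rewrite mulr_suml; apply: eq_bigr => i _; rewrite mulrA.
Qed.

(** The 8 pi collects the 1/2 of [eigval] and the 1 / (4 pi) left of [Psi_cst ^+ 2 * gap / (2 |n|)];
    the factor [rho ^ |n|] of the eigenvalue becomes the Poisson weight. *)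
Definition parity_cst s j x : R := (-1) ^+ s * tau s j * h0 x / (8 * pi).

Lemma partial_sumE s F j x :
  partial_sum r eps s F phi j x = (parity_cst s j x)%:C *
  \sum_(n <- F) (w n)%:C * expi (n%:~R * x) * fourier_coef (g s) n.
Proof.
rewrite /partial_sum big_mkcond mulr_sumr; apply: eq_bigr => n _.
(* The frequency 0, skipped on the left, contributes 0 on the right because [phi] has mean zero on
   each circle. *)
have [->|n0] /= := eqVneq n 0.
  rewrite fourier_coef_parity_part big1 ?mulr0// => i _.
  by rewrite fourier_coef0 f0 mulr0.
rewrite /tensor (HdotE hr heps s n0 phiL) -fourier_coef_parity_part PsiE.
rewrite /eigval rho_expE.
have c2 := Psi_cst2 hr heps s n0; have g0 := gap_gt0 hr heps s n0.
have a0 := absz_gt0R (R:=R) n0.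
have E3 (a b c : R) (z e : R[i]) :
    a%:C * (b%:C * z * (c%:C * e)) = (a * b * c)%:C * (e * z).
  by rewrite !rmorphM/=; ring.
have E2 (a b : R) (z e : R[i]) : a%:C * (b%:C * e * z) = (a * b)%:C * (e * z).
  by rewrite rmorphM/=; ring.
rewrite E3 E2; congr (_%:C * _); rewrite /parity_cst /poisson_weight.
move: (h0 x) (Psi_cst r eps s n) (gap r eps s n) (`|n|%N%:R : R) (tau s j : R)
  ((-1) ^+ s : R) (rho ^+ _) (pi : R) c2 g0 a0 pin0.
move=> y c d a u e q p c2 d0 a0 p0.
transitivity (c ^+ 2 * (e * q * d * u * y / (4 * a))); first by field; rewrite gt_eqF.
by rewrite c2; field; rewrite p0 !gt_eqF.
Qed.

(** Over the two values of [s], the contributions of [phi j] have opposite signs and cancel, while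
    those of the other circle are equal; hence 8 pi where [npopE] has 4 pi. *)
Lemma npop_parity_part j x : A x -> npop r eps phi j x =
  \sum_(s : bool) (parity_cst s j x)%:C * conv P (g s) x.
Proof.
move=> Ax; have [i ji] := exists_neq j.
have kP' y : cintegrable (fun t => (P (x - t))%:C * ang (phi y) t).
  exact: (cintegrable_kernel x kP).
have cE s : conv P (g s) x = \sum_(k < 2) (tau s k)%:C * conv P (ang (phi k)) x.
  rewrite /conv (eq_cintegral (g := fun t =>
    \sum_(k < 2) (tau s k)%:C * ((P (x - t))%:C * ang (phi k) t))).
    rewrite cintegral_sum => [|k]; last exact: cintegrableZ.
    by apply: eq_bigr => k _; rewrite cintegralZ.
  by move=> t _; rewrite mulr_sumr; apply: eq_bigr => k _; rewrite mulrCA.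
have {}cE s : conv P (g s) x = (tau s j)%:C * conv P (ang (phi j)) x +
    (- (-1) ^+ s * tau s j)%:C * conv P (ang (phi i)) x.
  rewrite cE (bigD1 j)//= (big_pred1 i); last by move=> k /=; rewrite (neq_ord2 k ji).
  by rewrite (tau_neq s ji).
rewrite (npopE hr heps ji Ax phiL) big_bool/= !cE /parity_cst.
have E (e u y : R) (z z' : R[i]) : e ^+ 2 = 1 -> u ^+ 2 = 1 ->
    (e * u * y / (8 * pi))%:C * (u%:C * z' + (- e * u)%:C * z) =
    (y / (8 * pi))%:C * (e%:C * z' - z).
  move=> e2 u2; rewrite mulrDr !mulrA -!rmorphM mulrBr !mulrA -!rmorphM/= -mulNr -rmorphN/=.
  congr (_%:C * _ + _%:C * _).
  - transitivity (u ^+ 2 * (e * y / (8 * pi))); first by ring.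
    by rewrite u2; ring.
  - transitivity (- (e ^+ 2 * u ^+ 2 * (y / (8 * pi)))); first by ring.
    by rewrite e2 u2; ring.
rewrite !E ?tau2 ?expr1 ?expr0 ?expr1n ?sqrrN ?expr1n// -mulrDr.
have -> : - (h0 x / (4 * pi)) = (h0 x / (8 * pi)) * -2.
  by move: (h0 x) (pi : R) pin0 => y p p0; field.
rewrite rmorphM/= -mulrA; congr (_ * _).
rewrite rmorphN rmorph1 rmorphN/= (rmorph_nat (real_complex R) 2).
ring.
Qed.

(** Each sign is estimated separately against its own parity part, which lets the two index sets
    differ. *)
Lemma npop_sub_partial_sum N F G j x : A x ->
  {subset ints N <= F} -> {subset ints N <= G} ->
  norm1 (npop r eps phi j x -
    (partial_sum r eps false F phi j x + partial_sum r eps true G phi j x)) <=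
  h0 x / (4 * pi) * (2 * err N * \sum_(i < 2) L1norm (ang (phi i))).
Proof.
move=> Ax NF NG; set X := \sum_(i < 2) _.
have e0 : 0 <= 2 * err N.
  have /andP[r0 r1] := rho01 hr heps.
  by rewrite mulr_ge0// divr_ge0 ?mulr_ge0 ?exprn_ge0 ?subr_ge0// ltW.
have D s (B : {fset int}) : {subset ints N <= B} ->
    norm1 ((parity_cst s j x)%:C * conv P (g s) x - partial_sum r eps s B phi j x) <=
    h0 x / (8 * pi) * (2 * err N * X).
  move=> NB; rewrite partial_sumE -mulrBr norm1RM.
  have -> : `|parity_cst s j x| = h0 x / (8 * pi).
    have p8 : 0 < 8 * pi :> R by rewrite mulr_gt0.
    rewrite /parity_cst -mulrA normrM normrM normr_sign normr_tau !mul1r.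
    exact: (ger0_norm (divr_ge0 (ltW (hg x)) (ltW p8))).
  rewrite ler_wpM2l//.
    have p8 : 0 < 8 * pi :> R by rewrite mulr_gt0.
    exact: (divr_ge0 (ltW (hg x)) (ltW p8)).
  apply: le_trans (ler_wpM2l e0 (L1norm_parity_part s)).
  have [mP _ _] := kP; apply: norm1_kernel_trigpoly => //.
  - by move=> y; apply: norm1_poisson_trigpoly => //; [exact: rho01|exact: fset_uniq].
  - exact: parity_part_integrable.
  - exact: (cintegrable_kernel x kP (parity_part_integrable s)).
rewrite npop_parity_part// big_bool/= [X in _ - X]addrC opprD addrACA.
rewrite (le_trans (norm1D _ _))//.
have -> : h0 x / (4 * pi) * (2 * err N * X) =
    h0 x / (8 * pi) * (2 * err N * X) + h0 x / (8 * pi) * (2 * err N * X).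
  by move: (h0 x) (pi : R) pin0 => y p p0; field.
by rewrite lerD// D.
Qed.

Lemma L1norm_sum_sq : (\sum_(i < 2) L1norm (ang (phi i))) ^+ 2 <=
  8 * pi / h_min r eps * \sum_(i < 2) energy r eps phi i.
Proof.
case: phiL => pL _; have L i := L1norm_angular hr heps i pL.
rewrite !big_ord_recl !big_ord0 !addr0.
have := L ord0; have := L (lift ord0 ord0).
move: (L1norm _) (L1norm _) (energy _ _ _ _) (energy _ _ _ _) => a b e e' a2 b2.
have -> : 8 * pi / h_min r eps * (e + e') =
    2 * (2 * pi * (2 / h_min r eps * e) + 2 * pi * (2 / h_min r eps * e')).
  by ring.
by have := sqr_ge0 (a - b); nra.
Qed.

(** The pointwise error is proportional to [h0]; squared and divided by [h0] it leaves one factor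
    [h_max]. Integrating over the two circles gives 4 pi / (4 pi)^2, and [L1norm_sum_sq] brings 8 pi
    / [h_min], whence the constant 2 [h_max] / [h_min]. *)
Lemma L2norm2_remainder N F G :
  {subset ints N <= F} -> {subset ints N <= G} ->
  (L2norm2 r eps (fun j t => (npop r eps phi j t -
     (partial_sum r eps false F phi j t + partial_sum r eps true G phi j t))%R)
   <= (2 * (h_max r eps / h_min r eps) * (2 * err N) ^+ 2)%:E *
      L2norm2 r eps phi)%E.
Proof.
move=> NF NG; have [[mK _] _] := npop_in_L20 phiL; have [pL _] := phiL.
set D : density := fun j t => _.
set k := 2 * err N; set X := \sum_(i < 2) L1norm (ang (phi i)).
have mS s (B : {fset int}) j : cmeasurable (partial_sum r eps s B phi j).
  rewrite (_ : partial_sum _ _ _ _ _ _ = fun x => (parity_cst s j x)%:C *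
    \sum_(n <- B) (w n)%:C * expi (n%:~R * x) * fourier_coef (g s) n); last first.
    by apply/funext => x; rewrite partial_sumE.
  apply: cmeasurableM.
    apply: cmeasurableR; apply: measurable_funM; last exact: measurable_cst.
    apply: measurable_funM; first exact: measurable_cst.
    by apply: measurable_funTS; exact: measurable_h.
  apply: cmeasurable_sum => n; apply: cmeasurableM; last exact: cmeasurable_cst.
  by apply: cmeasurableM; [exact: cmeasurable_cst|exact: cmeasurable_expiZ].
have mD j : cmeasurable (D j).
  by apply: cmeasurableB; [exact: mK|exact: cmeasurableD].
have hM := h_max_gt0 hr heps; have hm := h_min_gt0 hr heps.
have Db j t : A t -> normc2 (D j t) / h0 t <= h_max r eps / (4 * pi) ^+ 2 * (k * X) ^+ 2.
  move=> At; have h1 := hg t; have h2 := h_le hr heps t.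
  have n1 := npop_sub_partial_sum j At NF NG.
  rewrite -/k -/X -/(D j t) in n1.
  have n2 : normc2 (D j t) <= (h0 t / (4 * pi) * (k * X)) ^+ 2.
    rewrite (le_trans (normc2_le_norm1 _))// lerXn2r ?nnegrE ?norm1_ge0//.
    exact: le_trans (norm1_ge0 _) n1.
  move: (h0 t) h1 h2 n2 => y y0 yM n2; rewrite ler_pdivrMr// (le_trans n2)//.
  have -> : (y / (4 * pi) * (k * X)) ^+ 2 = y * (((k * X) / (4 * pi)) ^+ 2 * y).
    by ring.
  have -> : h_max r eps / (4 * pi) ^+ 2 * (k * X) ^+ 2 * y =
      h_max r eps * (((k * X) / (4 * pi)) ^+ 2 * y).
    by rewrite [in RHS]expr_div_n; ring.
  by rewrite ler_wpM2r// mulr_ge0 ?sqr_ge0// ltW.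
have iD j : rintegrable (fun t => normc2 (D j t) / h0 t).
  apply: (@rintegrable_bounded _ (h_max r eps / (4 * pi) ^+ 2 * (k * X) ^+ 2)).
    exact: measurable_normc2.
  move=> t At; rewrite (ger0_norm (divr_ge0 (normc2_ge0 (D j t)) (ltW (hg t)))).
  exact: Db.
rewrite (L2norm2_energy iD) (L2norm2_energy (fun j => in_L2_energy hr heps j pL)).
rewrite -EFinM lee_fin.
have eD j : energy r eps D j <= 2 * pi * (h_max r eps / (4 * pi) ^+ 2 * (k * X) ^+ 2).
  by apply: Rintegral_le_cst; [exact: iD|exact: Db].
have XE := L1norm_sum_sq; rewrite -/X in XE.
have -> : 2 * (h_max r eps / h_min r eps) * k ^+ 2 * (\sum_(j < 2) energy r eps phi j) =
    h_max r eps * k ^+ 2 / (4 * pi) * (8 * pi / h_min r eps * \sum_(j < 2) energy r eps phi j).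
  move: (\sum_(j < 2) _) (h_max r eps) (h_min r eps) hm (pi : R) pin0.
  by move=> e M m m0 p p0; field; rewrite p0 gt_eqF.
have c0 : 0 <= h_max r eps * k ^+ 2 / (4 * pi).
  exact: (divr_ge0 (mulr_ge0 (ltW hM) (sqr_ge0 k)) (mulr_ge0 (ler0n _ _) (ltW pi0))).
apply: le_trans (ler_wpM2l c0 XE).
apply: le_trans (ler_sum _ (fun j _ => eD j)) _.
rewrite sumr_const card_ord mulr2n le_eqVlt; apply/orP; left; apply/eqP.
by move: (h_max r eps) (pi : R) pin0 => M p p0; field.
Qed.

End SpectralDecomposition.

Theorem theorem3p2 (R : realType) (r eps : R) (hr : 0 < r) (heps : 0 < eps) :
  (* the Psi^(+/-)_n are eigenvectors *)
  (forall (s : bool) (n : int), n != 0 ->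
     in_L20 r eps (Psi r eps s n) /\
     (forall (j : 'I_2) (t : R), angles t ->
        npop r eps (Psi r eps s n) j t
        = (eigval r eps s n)%:C * Psi r eps s n j t)) /\
  (* they are normalized and mutually orthogonal *)
  (forall (s s' : bool) (m n : int), m != 0 -> n != 0 ->
     Hdot r eps (Psi r eps s m) (Psi r eps s' n) = ((s == s') && (m == n))%:R) /\
  (* both series converge unconditionally in operator norm, with sum K^* *)
  (forall phi : density, in_L20 r eps phi -> in_L20 r eps (npop r eps phi)) /\
  (forall eta : R, 0 < eta ->
     exists A : {fset int}, forall F G : {fset int},
       (A `<=` F)%fset -> (A `<=` G)%fset ->
       forall phi : density, in_L20 r eps phi ->
         (L2norm2 r eps (fun j t =>
            (npop r eps phi j t - (partial_sum r eps false F phi j t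
                                   + partial_sum r eps true G phi j t))%R)
          <= (eta ^+ 2)%:E * L2norm2 r eps phi)%E).
Proof.
split; first by move=> s n n0; split; [exact: Psi_in_L20|move=> j t; exact: npop_Psi].
split; first by move=> s s' m n; exact: Psi_orthonormal.
split; first by move=> phi; exact: npop_in_L20.
move=> eta eta0.
have hM := h_max_gt0 hr heps; have hm := h_min_gt0 hr heps.
pose c := 2 * (h_max r eps / h_min r eps).
have c0 : 0 < c by rewrite mulr_gt0// divr_gt0.
have [N errN] : exists N, c * (2 * kernel_err (rho r eps) N) ^+ 2 <= eta ^+ 2.
  have e0 := kernel_err_cvg (rho01 hr heps).
  have : (c * (2 * kernel_err (rho r eps) N) ^+ 2 @[N --> \oo] --> c * (2 * 0) ^+ 2)%classic.
    have e1 : (2 * kernel_err (rho r eps) N @[N --> \oo] --> 2 * (0 : R))%classic.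
      by apply: cvgM => //; exact: cvg_cst.
    by apply: cvgM; [exact: cvg_cst|rewrite !expr2; exact: cvgM].
  rewrite mulr0 expr0n mulr0 => /cvgr0_norm_le /(_ (eta ^+ 2)).
  rewrite exprn_gt0// => /(_ isT) [N _ /(_ N (leqnn N)) HN].
  by exists N; apply: le_trans (ler_norm _) HN.
(* [N] was chosen from [eta] and the geometry alone, so this set serves all [phi] at once:
   convergence is in operator norm. *)
exists [fset n | n in ints N]%fset => F G AF AG phi phiL.
have sub (B : {fset int}) : ([fset n | n in ints N] `<=` B)%fset ->
    {subset ints N <= B}.
  by move=> /fsubsetP AB n nN; apply: AB; rewrite in_fset.
apply: le_trans (L2norm2_remainder hr heps phiL (sub F AF) (sub G AG)) _.
apply: lee_wpmul2r; last by rewrite lee_fin.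
apply: sume_ge0 => j _; apply: integral_ge0 => t _; rewrite lee_fin.
exact: (divr_ge0 (normc2_ge0 _) (ltW (h_gt0 hr heps t))).
Qed.
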